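(* For each $n$, let $\mathbf d=(d(1),\dots,d(n))$ be a sequence of integers with $1\le d(1)\le\dots\le d(n)$ and even sum, let $M=\sum_i d(i)$, $\Delta=d(n)$, and let $p=p(n)\in(0,1)$ satisfy $p<1-\varepsilon$ for a constant $\varepsilon>0$ and $\Delta^2p^{-12}\log^{12}M\le \delta pM$ for a function $\delta=\delta(n)\to0$ with $\delta^{-1}=O(\log\log M)$. Let $G$ be a uniformly random simple graph on $[n]$ with degree sequence $\mathbf d$ and let $S\subseteq[n]$ be obtained by including each vertex independently with probability $p$ (independently of $G$). Let $C_p=\delta^{-1/16}p^{-1}\log M$. Then with probability $1-o(1)$: (a) $|S|=np\bigl(1\pm 3\sqrt{\log n/(pn)}\bigr)$; (b) $d(S)=pM\bigl(1\pm p^2M^{-1/4}\bigr)$; (c) $d_S(v)=p\,d(v)(1\pm 9\delta^{1/64})$ for all $v\in S$ with $d(v)>2\delta^{1/32}C_p$; (d) for all integers $0\le i\le \tfrac13 pC_p$, $$|n_i(\mathbf d_S)-n_i(\mathbf d_A)|\le \frac{p\,n_i(\mathbf d_A)}{C_p^3}(1+o(1))+\frac{pC_p^6}{\sqrt{\log M}}.$$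
   Context: $d(A)=\sum_{i\in A}d(i)$; $d_S(v)$ is the degree of $v$ in $G[S]$; $\mathbf d_S$ is the degree sequence of $G[S]$ and $n_i(\mathbf d_S)$ the number of vertices of $S$ of degree $i$ in $G[S]$. For a sequence $\mathbf x$, $n_k(\mathbf x)$ is the number of entries equal to $k$. Definition of $\mathbf d_A$: let $X_j\sim\mathrm{Bin}(j,p)$; for $k\ge0$ let $\tilde N(k)=\lfloor p\sum_{i\in[n]}\Pr(X_{d(i)}\le k)+\tfrac12\rfloor$ and $\tilde N(-1)=0$; $\mathbf d_A$ is the non-decreasing sequence with $n_k(\mathbf d_A)=\tilde N(k)-\tilde N(k-1)$. The notation $x=y(1\pm\epsilon)$ means $|x-y|\le\epsilon y$. Asymptotics are as $n\to\infty$. *)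

(* Defs.v *)
From HB Require Import structures.
From mathcomp Require Import all_boot all_order all_algebra.
From mathcomp Require Import all_classical all_reals all_analysis.
Set Implicit Arguments. Unset Strict Implicit. Unset Printing Implicit Defensive.
Import Order.TTheory GRing.Theory Num.Theory.
Local Open Scope ring_scope.

Definition simple_graph (n : nat) (E : {set {set 'I_n}}) : bool :=
  [forall e in E, #|e| == 2]%N.

Definition deg (n : nat) (E : {set {set 'I_n}}) (v : 'I_n) : nat :=
  #|[set e in E | v \in e]|.

Definition degS (n : nat) (E : {set {set 'I_n}}) (S : {set 'I_n}) (v : 'I_n) : nat :=
  #|[set e in E | (v \in e) && (e \subset S)]|.

Definition nS (n : nat) (E : {set {set 'I_n}}) (S : {set 'I_n}) (i : nat) : nat :=
  #|[set v in S | degS E S v == i]|.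

Definition dsum (n : nat) (dn : 'I_n -> nat) (A : {set 'I_n}) : nat :=
  (\sum_(i in A) dn i)%N.

Definition Msum (n : nat) (dn : 'I_n -> nat) : nat := (\sum_(i < n) dn i)%N.

(* Delta = d(n) = max degree (d is non-decreasing) *)
Definition Dmax (n : nat) (dn : 'I_n -> nat) : nat := (\max_(i < n) dn i)%N.

Definition graphs_deg (n : nat) (dn : 'I_n -> nat) : {set {set {set 'I_n}}} :=
  [set E | simple_graph E && [forall v, deg E v == dn v]].

Definition bern_weight (R : realType) (n : nat) (p : R) (A : {set 'I_n}) : R :=
  p ^+ #|A| * (1 - p) ^+ (n - #|A|).

Definition prob (R : realType) (n : nat) (dn : 'I_n -> nat) (p : R)
  (P : {set {set 'I_n}} -> {set 'I_n} -> Prop) : R :=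
  (#|graphs_deg dn|%:R)^-1 *
  \sum_(E in graphs_deg dn) \sum_(A : {set 'I_n}) bern_weight p A * (`[< P E A >])%:R.

Definition binom_cdf (R : realType) (j k : nat) (p : R) : R :=
  \sum_(t < k.+1) ('C(j, t))%:R * p ^+ t * (1 - p) ^+ (j - t).

Definition Ntilde (R : realType) (n : nat) (dn : 'I_n -> nat) (p : R) (k : nat) : int :=
  Num.floor (p * \sum_(i < n) binom_cdf (dn i) k p + 2^-1).

Definition nA (R : realType) (n : nat) (dn : 'I_n -> nat) (p : R) (k : nat) : int :=
  Ntilde dn p k - (if k is k'.+1 then Ntilde dn p k' else 0).

Definition Cp (R : realType) (delta p M : R) : R :=
  delta `^ (- (16%:R)^-1) * p^-1 * ln M.

(* The event (a)-(d) of the theorem, with the o(1) term in (d) given by eta. *)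
Definition good_event (R : realType) (n : nat) (dn : 'I_n -> nat) (p delta eta : R)
  (E : {set {set 'I_n}}) (S : {set 'I_n}) : Prop :=
  let M : R := (Msum dn)%:R in
  let C := Cp delta p M in
  `| #|S|%:R - n%:R * p | <= 3%:R * Num.sqrt (ln n%:R / (p * n%:R)) * (n%:R * p) /\
  `| (dsum dn S)%:R - p * M | <= p ^+ 2 * M `^ (- (4%:R)^-1) * (p * M) /\
  (forall v, v \in S -> 2%:R * delta `^ ((32%:R)^-1) * C < (dn v)%:R ->
     `| (degS E S v)%:R - p * (dn v)%:R | <= 9%:R * delta `^ ((64%:R)^-1) * (p * (dn v)%:R)) /\
  (forall i : nat, i%:R <= p * C / 3%:R ->
     `| (nS E S i)%:R - (nA dn p i)%:~R |
       <= p * (nA dn p i)%:~R / C ^+ 3 * (1 + eta) + p * C ^+ 6 / Num.sqrt (ln M)).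

(* Main.v *)
(* For every fixed graph E, [degS E S v] given v in S is exactly Bin(d(v), p), so
   the conditional mean of [nS E S i] is p * sum_v P(Bin(d(v), p) = i), whatever
   E is, and it differs from n_i(d_A) only by rounding. Parts (a) and (b) follow
   from Chebyshev, part (c) from Chernoff and a union bound; (c) also
   shows that vertices of degree above C_p do not contribute to (d).

   For (d) the variance over the pair (E, S) of the contribution of the vertices
   of degree at most C_p is bounded. The events of two vertices v and w are
   independent given E unless the closed neighbourhoods N[v] and N[w] meet; if
   they share at most two vertices, the joint probability exceeds the product of
   the two probabilities by at most the factor (p (1 - p))^-2. Averaged over E,
   N[v] and N[w] meet with probability O(C_p^2 Delta / M) and share more than two
   vertices with probability O(C_p^4 Delta^2 / M^2), since a switching argument
   bounds the probability that E contains a given set of at most four edges uv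
   by the product of the quantities 2 d(u) d(v) / M. No correction term is
   needed: the theorem holds with the o(1) of (d) equal to 0. *)
Require Import Defs.
From HB Require Import structures.
From mathcomp Require Import all_boot all_order all_algebra.
From mathcomp Require Import all_classical all_reals all_analysis.
From mathcomp Require Import ring lra zify.
Set Implicit Arguments. Unset Strict Implicit. Unset Printing Implicit Defensive.
Import Order.TTheory GRing.Theory Num.Theory numFieldNormedType.Exports.
Local Open Scope ring_scope.

(** * Expectation over a random vertex subset *)

Definition bexp (R : realType) (n : nat) (p : R) (f : {set 'I_n} -> R) : R :=
  \sum_(A : {set 'I_n}) bern_weight p A * f A.

Section BernoulliExpectation.
Variables (R : realType) (n : nat) (p : R).
Implicit Types (A B K U W : {set 'I_n}) (f g : {set 'I_n} -> R).

Lemma bern_weightE A :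
  bern_weight p A = \prod_(i < n) (if i \in A then p else 1 - p).
Proof.
rewrite /bern_weight (bigID (mem A)) /=; congr (_ * _).
  by rewrite -[LHS]prodr_const; apply: eq_bigr => i ->.
rewrite (eq_bigr (fun=> 1 - p)); last by move=> i /negbTE ->.
have -> : (n - #|A| = #|~: A|)%N by have := cardsC A; rewrite card_ord; lia.
by rewrite -prodr_const; apply: eq_bigl => i; rewrite inE.
Qed.

(** Expanding the product of two-term sums gives one term for each subset: the set of indices at
    which the first summand is chosen. *)
Lemma bexp_prod (F : 'I_n -> bool -> R) :
  bexp p (fun A => \prod_(i < n) F i (i \in A)) =
  \prod_(i < n) (p * F i true + (1 - p) * F i false).
Proof.
rewrite bigA_distr; apply: eq_bigr => A _.
rewrite bern_weightE -big_split; apply: eq_bigr => i _ /=.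
by case: ifP.
Qed.

Lemma bexp_cst c : @bexp R n p (fun=> c) = c.
Proof.
rewrite /bexp -mulr_suml.
have := bexp_prod (fun _ _ => 1).
rewrite /bexp [X in _ = X -> _]big1 => [|i _]; last by rewrite !mulr1 addrC subrK.
rewrite (eq_bigr (bern_weight p)) => [->|A _]; first by rewrite mul1r.
by rewrite big1 ?mulr1.
Qed.

Lemma eq_bexp f g : f =1 g -> bexp p f = bexp p g.
Proof. by move=> fg; apply: eq_bigr => A _; rewrite fg. Qed.

Lemma bexpD f g : bexp p (fun A => f A + g A) = bexp p f + bexp p g.
Proof. by rewrite -big_split; apply: eq_bigr => A _; rewrite mulrDr. Qed.

Lemma bexpZ c f : bexp p (fun A => c * f A) = c * bexp p f.
Proof. by rewrite mulr_sumr; apply: eq_bigr => A _; rewrite mulrCA. Qed.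

Lemma bexpB f g : bexp p (fun A => f A - g A) = bexp p f - bexp p g.
Proof. by rewrite -sumrB; apply: eq_bigr => A _; rewrite mulrBr. Qed.

Lemma bexp_sum (I : Type) (r : seq I) (P : pred I) (F : I -> {set 'I_n} -> R) :
  bexp p (fun A => \sum_(i <- r | P i) F i A) = \sum_(i <- r | P i) bexp p (F i).
Proof.
by rewrite exchange_big; apply: eq_bigr => A _; rewrite mulr_sumr.
Qed.

(* The involution exchanging the parts of A and B outside U preserves the product measure. *)
Lemma bexp_resample U f :
  bexp p f = \sum_A \sum_B bern_weight p A * bern_weight p B * f ((A :&: U) :|: (B :\: U)).
Proof.
pose sw (X : {set 'I_n} * {set 'I_n}) : {set 'I_n} * {set 'I_n} :=
  ((X.1 :&: U) :|: (X.2 :\: U), (X.2 :&: U) :|: (X.1 :\: U)).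
have swK : involutive sw.
  move=> [A B]; congr (_, _); apply/setP => i; rewrite !inE /=;
  by case: (i \in U); case: (i \in A); case: (i \in B).
rewrite pair_big /=.
transitivity (\sum_(X : {set 'I_n} * {set 'I_n})
   bern_weight p X.1 * bern_weight p X.2 * f X.1).
  rewrite -(pair_big xpredT xpredT (fun A B => bern_weight p A * bern_weight p B * f A)) /=.
  apply: eq_bigr => A _; rewrite -mulr_suml; congr (_ * _).
  rewrite -mulr_sumr; have := bexp_cst 1; rewrite /bexp.
  by under eq_bigr do rewrite mulr1; move=> ->; rewrite mulr1.
rewrite (reindex_inj (inv_inj swK)) /=; apply: eq_bigr => -[A B] _ /=; congr (_ * _).
rewrite !bern_weightE -!big_split; apply: eq_bigr => i _; rewrite !inE.
by case: (i \in U); case: (i \in A); case: (i \in B) => //=; rewrite mulrC.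
Qed.

Definition depends_on U f := forall A, f A = f (A :&: U).

(** Resample outside [U] from an independent copy [B]. Then [f] sees only [A] and, as [W] avoids
    [U], [g] sees only [B], so the double sum factors. *)
Lemma bexp_indep U W f g : [disjoint U & W] -> depends_on U f -> depends_on W g ->
  bexp p (fun A => f A * g A) = bexp p f * bexp p g.
Proof.
move=> dUW fU gW; rewrite (bexp_resample U) /bexp big_distrl /=.
apply: eq_bigr => A _; rewrite big_distrr /=; apply: eq_bigr => B _.
rewrite (fU (_ :|: _)) (gW (_ :|: _)) [f A]fU [g B]gW.
have -> : ((A :&: U) :|: (B :\: U)) :&: U = A :&: U.
  by apply/setP => i; rewrite !inE; case: (i \in U); rewrite ?andbT ?andbF ?orbF.
have -> : ((A :&: U) :|: (B :\: U)) :&: W = B :&: W.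
  apply/setP => i; rewrite !inE; case: (boolP (i \in W)) => iW; rewrite ?andbT ?andbF //.
  have -> : i \in U = false by rewrite (disjointFl dUW iW).
  by rewrite andbF.
by rewrite mulrACA.
Qed.

Lemma bexp_mem v : bexp p (fun A => (v \in A)%:R) = p.
Proof.
rewrite (eq_bexp (g := fun A => \prod_(i < n) (if i == v then (i \in A)%:R else 1))).
  rewrite (bexp_prod (fun i b => if i == v then b%:R else 1)).
  rewrite (bigD1 v) //= eqxx big1 ?mulr1 ?mulr0 ?addr0 // => i /negbTE ->.
  by rewrite !mulr1 addrC subrK.
by move=> A; rewrite (bigD1 v) //= eqxx big1 ?mulr1 // => i /negbTE ->.
Qed.

(** Resampling with [U = [set v]] leaves [A] to decide only whether [v] is present, while [B]
    supplies all other vertices. *)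
Lemma bexp_split1 v f :
  bexp p f = p * bexp p (fun A => f (v |: A)) + (1 - p) * bexp p (fun A => f (A :\ v)).
Proof.
rewrite (bexp_resample [set v]).
transitivity (\sum_A bern_weight p A *
   ((v \in A)%:R * bexp p (fun A => f (v |: A)) +
    (1 - (v \in A)%:R) * bexp p (fun A => f (A :\ v)))).
  apply: eq_bigr => A _.
  under eq_bigr do rewrite -mulrA; rewrite -mulr_sumr; congr (_ * _).
  case: (boolP (v \in A)) => vA; rewrite ?subrr ?subr0 ?mul0r ?mul1r ?addr0 ?add0r;
    apply: eq_bigr => B _; congr (_ * f _); apply/setP => i; rewrite !inE;
    case: eqP => [->|] //=; rewrite ?vA ?(negbTE vA) ?andbF //.
rewrite -/(bexp p _) bexpD; congr (_ + _).
  by rewrite (eq_bexp (g := fun A => bexp p (fun A0 => f (v |: A0)) * (v \in A)%:R))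
    => [|A]; rewrite ?bexpZ ?bexp_mem mulrC.
rewrite (eq_bexp (g := fun A => bexp p (fun A0 => f (A0 :\ v)) * (1 - (v \in A)%:R)))
    => [|A]; last by rewrite mulrC.
by rewrite bexpZ bexpB bexp_cst bexp_mem mulrC.
Qed.

Hypothesis p01 : 0 < p < 1.

Lemma bern_weight_ge0 A : 0 <= bern_weight p A.
Proof.
case/andP: p01 => p0 p1; rewrite /bern_weight mulr_ge0 ?exprn_ge0 ?subr_ge0 //; exact: ltW.
Qed.

Lemma bexp_le f g : (forall A, f A <= g A) -> bexp p f <= bexp p g.
Proof.
by move=> fg; apply: ler_sum => A _; rewrite ler_wpM2l ?bern_weight_ge0.
Qed.

Lemma bexp_ge0 f : (forall A, 0 <= f A) -> 0 <= bexp p f.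
Proof. by move=> f0; apply: sumr_ge0 => A _; rewrite mulr_ge0 ?bern_weight_ge0. Qed.

(* Condition on the vertices of [U :&: W] one at a time: fixing the state of a
   vertex, which has probability p or 1 - p, increases the expectation of a
   nonnegative function by at most the factor 1 / p or 1 / (1 - p). *)
Lemma bexp_mul_le U W f g : depends_on U f -> depends_on W g ->
  (forall A, 0 <= f A) -> (forall A, 0 <= g A) ->
  bexp p (fun A => f A * g A) <=
  (p * (1 - p))^-1 ^+ #|U :&: W| * (bexp p f * bexp p g).
Proof.
case/andP: p01 => p0 p1; have q0 : 0 < 1 - p by rewrite subr_gt0.
move: {2}(#|U :&: W|) (erefl #|U :&: W|) => k.
elim: k U W f g => [|k IH] U W f g cUW fU gW f0 g0.
  rewrite cUW expr0 mul1r (bexp_indep (U := U) (W := W)) //.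
  by rewrite -setI_eq0; apply/eqP/cards0_eq.
have [v vK] : exists v, v \in U :&: W by apply/card_gt0P; rewrite cUW.
have := vK; rewrite inE => /andP[vU vW].
have E1 : bexp p (fun A => f A * g A) = _ := bexp_split1 v _.
(* Once the state of [v] is fixed, neither function depends on [v], so the overlap of the two
   supports drops by one. *)
have dep (b : bool) V h : depends_on V h ->
   depends_on (V :\ v) (fun A => h (if b then v |: A else A :\ v)).
  move=> hV A; case: b; rewrite hV [RHS]hV; congr h; apply/setP => i; rewrite !inE;
  by case: eqP => //=; case: (i \in V); rewrite ?andbT ?andbF.
have cK : #|(U :\ v) :&: (W :\ v)| = k.
  have -> : (U :\ v) :&: (W :\ v) = (U :&: W) :\ v.
    by apply/setP => i; rewrite !inE; case: eqP => //=; rewrite andbF.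
  by have := cardsD1 v (U :&: W); rewrite cUW vK => -[].
have IHb (b : bool) := IH (U :\ v) (W :\ v) _ _ cK (dep b U f fU) (dep b W g gW)
   (fun A => f0 _) (fun A => g0 _).
have := IHb true; have := IHb false; rewrite {IHb} cK /= => IH0 IH1.
have := bexp_split1 v f; have := bexp_split1 v g.
have f10 : 0 <= bexp p (fun A => f (v |: A)) by apply: bexp_ge0.
have f00 : 0 <= bexp p (fun A => f (A :\ v)) by apply: bexp_ge0.
have g10 : 0 <= bexp p (fun A => g (v |: A)) by apply: bexp_ge0.
have g00 : 0 <= bexp p (fun A => g (A :\ v)) by apply: bexp_ge0.
rewrite E1 => -> ->; rewrite cUW exprS.
move: IH0 IH1 f10 f00 g10 g00.
set x1 := bexp p (fun A => f (v |: A)); set x0 := bexp p (fun A => f (A :\ v)).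
set y1 := bexp p (fun A => g (v |: A)); set y0 := bexp p (fun A => g (A :\ v)).
set z1 := bexp p (fun A => f (v |: A) * _); set z0 := bexp p (fun A => f (A :\ v) * _).
set c := _ ^+ k => IH0 IH1 f10 f00 g10 g00.
have c0 : 0 <= c by rewrite exprn_ge0 // invr_ge0 mulr_ge0 // ltW.
apply: (@le_trans _ _ (c * (p * (x1 * y1) + (1 - p) * (x0 * y0)))).
  by rewrite mulrDr (mulrCA c p) (mulrCA c (1 - p)); apply: lerD; apply: ler_wpM2l => //; apply: ltW.
rewrite [leRHS]mulrAC [leRHS]mulrC ler_wpM2l // ler_pdivlMl; last by rewrite mulr_gt0.
have x1y1 : 0 <= x1 * y1 by rewrite mulr_ge0.
have x0y0 : 0 <= x0 * y0 by rewrite mulr_ge0.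
have x1y0 : 0 <= x1 * y0 by rewrite mulr_ge0.
have x0y1 : 0 <= x0 * y1 by rewrite mulr_ge0.
have pq : 0 <= p * (1 - p) by rewrite mulr_ge0 // ltW.
(* The right side contains both diagonal terms in full, the left side carries them with factors
   [1 - p] and [p], and the cross terms are nonnegative. *)
have -> : (p * x1 + (1 - p) * x0) * (p * y1 + (1 - p) * y0) =
   p ^+ 2 * (x1 * y1) + (1 - p) ^+ 2 * (x0 * y0) +
   p * (1 - p) * (x1 * y0) + p * (1 - p) * (x0 * y1) by ring.
have -> : p * (1 - p) * (p * (x1 * y1) + (1 - p) * (x0 * y0)) =
   (1 - p) * (p ^+ 2 * (x1 * y1)) + p * ((1 - p) ^+ 2 * (x0 * y0)) by ring.
have h1 : 0 <= p * (1 - p) * (x1 * y0) by rewrite mulr_ge0.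
have h2 : 0 <= p * (1 - p) * (x0 * y1) by rewrite mulr_ge0.
have h3 : (1 - p) * (p ^+ 2 * (x1 * y1)) <= p ^+ 2 * (x1 * y1).
  by apply: ler_piMl; [rewrite mulr_ge0 // sqr_ge0 | lra].
have h4 : p * ((1 - p) ^+ 2 * (x0 * y0)) <= (1 - p) ^+ 2 * (x0 * y0).
  by apply: ler_piMl; [rewrite mulr_ge0 // sqr_ge0 | lra].
lra.
Qed.

End BernoulliExpectation.

Arguments eq_bexp {R n p f g}.
Arguments bexp_indep {R n p U W f g}.
Arguments bexp_split1 {R n p}.

(** * Binomial counts and their tails *)

Section BinomialTails.
Variables (R : realType) (n : nat) (p : R).
Implicit Types (A N : {set 'I_n}).

Definition binpmf (j i : nat) : R := 'C(j, i)%:R * p ^+ i * (1 - p) ^+ (j - i).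

Lemma binpmfS j i : binpmf j.+1 i.+1 = p * binpmf j i + (1 - p) * binpmf j i.+1.
Proof.
rewrite /binpmf binS natrD subSS exprS.
(* For [i < j] this is Pascal's rule; for [i >= j] the subtraction in the exponent is truncated, but
   the coefficient C(j, i+1) is zero. *)
have [ij|ji] := ltnP i j.
  by rewrite -(subnSK ij) exprS; ring.
by rewrite (@bin_small j i.+1) // add0r; ring.
Qed.

Lemma bexp_card_eq N i : bexp p (fun A => (#|A :&: N| == i)%:R) = binpmf #|N| i.
Proof.
elim: {N}#|N| {-2}N i (erefl #|N|) => [|k IH] N i cN.
  have -> : N = finset.set0 by apply/cards0_eq.
  rewrite (eq_bexp (g := fun=> (0%N == i)%:R)) => [|A]; last by rewrite finset.setI0 cards0.
  by rewrite bexp_cst cards0 /binpmf; case: i => [|i]; rewrite ?bin0 ?bin0n ?mul0r ?expr0 ?mulr1.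
have [v vN] : exists v, v \in N by apply/card_gt0P; rewrite cN.
have cN' : #|N :\ v| = k by have := cardsD1 v N; rewrite cN vN => -[].
rewrite (bexp_split1 v) cN.
have e0 A : (A :\ v) :&: N = A :&: (N :\ v).
  by apply/setP => w; rewrite !inE; case: eqP; rewrite ?andbF.
have e1 A : #|(v |: A) :&: N| = #|A :&: (N :\ v)|.+1.
  rewrite (cardsD1 v) !inE eqxx vN /= add1n; congr (_.+1); apply: eq_card => w.
  by rewrite !inE; case: eqP; rewrite ?andbF.
have -> : bexp p (fun A => (#|(A :\ v) :&: N| == i)%:R) = binpmf k i.
  by rewrite -cN' -(IH _ _ cN'); apply: eq_bexp => A; rewrite e0.
case: i => [|i].
  rewrite (eq_bexp (g := fun=> 0)) => [|A]; last by rewrite e1.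
  by rewrite bexp_cst mulr0 add0r /binpmf !bin0 !subn0 exprS; ring.
rewrite binpmfS; congr (_ * _ + _).
by rewrite -cN' -(IH _ _ cN'); apply: eq_bexp => A; rewrite e1.
Qed.

Lemma bexp_vertex_card_eq (v : 'I_n) N i : v \notin N ->
  bexp p (fun A => ((v \in A) && (#|A :&: N| == i))%:R) = p * binpmf #|N| i.
Proof.
move=> vN; transitivity (bexp p (fun A => (v \in A)%:R * (#|A :&: N| == i)%:R)).
  by apply: eq_bexp => A; rewrite -natrM mulnb.
rewrite (bexp_indep (U := [set v]) (W := N)).
- by rewrite bexp_mem bexp_card_eq.
- by rewrite disjoints1.
- by move=> A; rewrite !inE eqxx andbT.
- by move=> A; rewrite -finset.setIA finset.setIid.
Qed.

(** * Generating function, second moment and Chernoff bound *)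

Lemma bexp_exprn_card (x : R) N :
  bexp p (fun A => x ^+ #|A :&: N|) = (1 - p + p * x) ^+ #|N|.
Proof.
transitivity (bexp p (fun A => \prod_(i < n) (if (i \in A) && (i \in N) then x else 1))).
  apply: eq_bexp => A; rewrite -big_mkcond -prodr_const /=.
  by apply: eq_bigl => i; rewrite inE.
rewrite (bexp_prod p (fun i b => if b && (i \in N) then x else 1)) /=.
rewrite -prodr_const [RHS]big_mkcond /=; apply: eq_bigr => i _.
by case: ifP => _; rewrite ?mulr1; [rewrite addrC | rewrite addrC subrK].
Qed.

(** From exp(-t) >= 1 - t one gets exp(t) <= 1/(1 - t), and (1 + t + 2t^2)(1 - t) = 1 + t^2(1 - 2t)
    >= 1. Negative [t] is allowed, which later serves the lower tail. *)
Lemma expR_le_quadratic (t : R) : t <= 2^-1 -> expR t <= 1 + t + 2 * t ^+ 2.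
Proof.
move=> t2; have t1 : 0 < 1 - t by lra.
have h : 1 - t <= expR (- t) := expR_ge1Dx _.
rewrite -[t in expR t]opprK expRN.
apply: (@le_trans _ _ (1 - t)^-1).
  by rewrite lef_pV2 // ?posrE ?expR_gt0.
rewrite -[leLHS]mul1r ler_pdivrMr //.
have : 0 <= t ^+ 2 * (1 - 2 * t) by apply: mulr_ge0; [exact: sqr_ge0 | lra].
by rewrite expr2 => h2; lra.
Qed.

(** The centred indicators [X i] have mean 0 and are independent for distinct indices, so only the
    diagonal of the expanded square survives. *)
Lemma bexp_linear_variance (a : 'I_n -> R) :
  bexp p (fun A => (\sum_(i in A) a i - p * \sum_i a i) ^+ 2) =
  p * (1 - p) * \sum_i a i ^+ 2.
Proof.
pose X i A : R := (i \in A)%:R - p.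
have dX i : depends_on [set i] (X i) by move=> A; rewrite /X !inE eqxx andbT.
have X0 i : bexp p (X i) = 0 by rewrite bexpB bexp_mem // bexp_cst subrr.
have XX i : bexp p (fun A => X i A * X i A) = p * (1 - p).
  rewrite (eq_bexp (g := fun A => (1 - 2 * p) * (i \in A)%:R + p ^+ 2)).
    by rewrite bexpD bexpZ bexp_mem // bexp_cst //; ring.
  by move=> A; rewrite /X; case: (i \in A) => /=; ring.
rewrite (eq_bexp (g := fun A => \sum_i \sum_j (a i * a j) * (X i A * X j A))).
  rewrite bexp_sum mulr_sumr; apply: eq_bigr => i _.
  rewrite bexp_sum (bigD1 i) //= bexpZ XX big1 ?addr0 => [|j ji].
    by rewrite expr2 mulrC.
  rewrite bexpZ (bexp_indep (U := [set i]) (W := [set j])) ?X0 ?mulr0 //.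
  by rewrite disjoints1 inE eq_sym.
move=> A; have -> : \sum_(i in A) a i - p * \sum_i a i = \sum_i a i * X i A.
  rewrite big_mkcond mulr_sumr -sumrB; apply: eq_bigr => i _; rewrite /X.
  by case: (i \in A) => /=; ring.
rewrite expr2 mulr_suml; apply: eq_bigr => i _; rewrite mulr_sumr.
by apply: eq_bigr => j _; rewrite mulrACA.
Qed.

Hypothesis p01 : 0 < p < 1.

Lemma binpmf_ge0 j i : 0 <= binpmf j i.
Proof.
by case/andP: p01 => p0 p1; rewrite !mulr_ge0 ?exprn_ge0 ?subr_ge0 // ltW.
Qed.

(** Each factor 1 - p + p exp(t) is at most exp(p(exp(t) - 1)); the quadratic bound on exp(t) then
    leaves only the term in t^2 after centring. *)
Lemma bexp_mgf_le (t : R) N : t <= 2^-1 ->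
  bexp p (fun A => expR (t * (#|A :&: N|%:R - p * #|N|%:R))) <=
  expR (2 * t ^+ 2 * (p * #|N|%:R)).
Proof.
case/andP: p01 => p0 p1 t2.
rewrite (eq_bexp (g := fun A => expR (- (t * p * #|N|%:R)) * expR t ^+ #|A :&: N|)); last first.
  by move=> A; rewrite -expRM_natl -expRD; congr expR; rewrite -mulr_natl; ring.
rewrite bexpZ bexp_exprn_card.
apply: (@le_trans _ _ (expR (- (t * p * #|N|%:R)) * expR (p * (expR t - 1)) ^+ #|N|)).
  rewrite ler_wpM2l ?expR_ge0 //; apply: lerXn2r; rewrite ?nnegrE ?expR_ge0 //.
    by rewrite addr_ge0 ?subr_ge0 ?mulr_ge0 ?expR_ge0 // ltW.
  by apply: le_trans (expR_ge1Dx _); rewrite mulrBr; lra.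
rewrite -expRM_natl -expRD ler_expR.
have h := expR_le_quadratic t2.
have : p * #|N|%:R * (expR t - 1) <= p * #|N|%:R * (t + 2 * t ^+ 2).
  by rewrite ler_wpM2l ?mulr_ge0 ?ler0n ?(ltW p0) //; lra.
rewrite -mulr_natl; lra.
Qed.

Lemma binomial_chernoff (e : R) N : 0 < e <= 1 ->
  bexp p (fun A => (e * (p * #|N|%:R) < `| #|A :&: N|%:R - p * #|N|%:R |)%R%:R) <=
  2 * expR (- (e ^+ 2 * (p * #|N|%:R) / 8)).
Proof.
(* The choice t = e/4 minimises the exponent -tem + 2t^2 m, with value -e^2 m/8, and keeps [t] and
   [- t] below 1/2. *)
case/andP=> e0 e1; set m := p * #|N|%:R; pose t := e / 4.
have m0 : 0 <= m by rewrite mulr_ge0 ?ler0n // ltW //; case/andP: p01.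
apply: (@le_trans _ _ (bexp p (fun A => expR (- (t * e * m)) *
    (expR (t * (#|A :&: N|%:R - m)) + expR (- t * (#|A :&: N|%:R - m)))))).
  apply: bexp_le => // A; rewrite mulrDr -!expRD.
  case: ltrP => /= [|_]; last by rewrite addr_ge0 ?expR_ge0.
  set x := _ - m; rewrite ltr_normr => /orP[|] h.
  - apply: (@le_trans _ _ (expR (- (t * e * m) + t * x))); last by rewrite lerDl expR_ge0.
    rewrite -expR0 ler_expR.
    have : 0 <= t * (x - e * m) by rewrite mulr_ge0 /t; lra.
    lra.
  - apply: (@le_trans _ _ (expR (- (t * e * m) + - t * x))); last by rewrite lerDr expR_ge0.
    rewrite -expR0 ler_expR.
    have : 0 <= t * (- x - e * m) by rewrite mulr_ge0 /t; lra.
    lra.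
rewrite bexpZ bexpD.
have t1 : t <= 2^-1 by rewrite /t; lra.
have t1' : - t <= 2^-1 by rewrite /t; lra.
have h1 := bexp_mgf_le N t1; have h2 := bexp_mgf_le N t1'.
rewrite sqrrN in h2.
apply: (@le_trans _ _ (expR (- (t * e * m)) * (2 * expR (2 * t ^+ 2 * m)))).
  by rewrite ler_wpM2l ?expR_ge0 // mulr_natl mulr2n lerD.
rewrite mulrCA -expRD ler_wpM2l // ler_expR /t.
suff -> : - (e / 4 * e * m) + 2 * (e / 4) ^+ 2 * m = - (e ^+ 2 * m / 8) by [].
by field.
Qed.

End BinomialTails.

(** * Switchings of simple graphs *)

Definition nbh (n : nat) (E : {set {set 'I_n}}) (v : 'I_n) : {set 'I_n} :=
  [set w | [set v; w] \in E].

Section Neighbourhoods.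
Variable n : nat.
Implicit Types (E F : {set {set 'I_n}}) (u v w x y : 'I_n).

Lemma edge_neq E u v : simple_graph E -> [set u; v] \in E -> u != v.
Proof.
by move=> /forall_inP sE /sE; rewrite cards2; case: (u != v).
Qed.

Lemma nbh_irr E v : simple_graph E -> v \notin nbh E v.
Proof. by move=> sE; rewrite inE; apply/negP => /(edge_neq sE); rewrite eqxx. Qed.

(** The map sending [w] to the edge vw is a bijection from neighbours to edges at [v]. The predicate
    [P] lets one count serve both the full degree and the degree inside [S]. *)
Lemma card_edges_at E (P : pred {set 'I_n}) v : simple_graph E ->
  #|[set e in E | (v \in e) && P e]| = #|[set w in nbh E v | P [set v; w]]|.
Proof.
move=> sE; rewrite -(card_in_imset (f := fun w => [set v; w])) => [|w w']; last first.
  rewrite !inE => /andP[/(edge_neq sE) vw _] /andP[/(edge_neq sE) vw' _] eq_vw.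
  have : w \in [set v; w'] by rewrite -eq_vw !inE eqxx orbT.
  by rewrite !inE eq_sym (negbTE vw) => /eqP.
apply: eq_card => e; rewrite !inE; apply/idP/imsetP => [/and3P[eE ve Pe]|[w]]; last first.
  by rewrite !inE => /andP[wE Pw] ->; rewrite wE Pw !inE eqxx.
have /cards2P [x [y [xy exy]]] := forall_inP sE _ eE.
move: ve; rewrite exy !inE => /orP[/eqP vx|/eqP vy].
  by exists y; rewrite ?inE vx -?exy ?eE.
by exists x; rewrite ?inE vy finset.setUC -?exy ?eE.
Qed.

Lemma card_nbh E v : simple_graph E -> #|nbh E v| = deg E v.
Proof.
move=> sE; rewrite /deg; have := card_edges_at xpredT v sE.
have -> : [set w in nbh E v | xpredT [set v; w]] = nbh E v.
  by apply/setP => w; rewrite !inE andbT.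
by move=> <-; apply: eq_card => e; rewrite !inE andbT.
Qed.

Lemma degS_nbh E (S : {set 'I_n}) v : simple_graph E -> v \in S ->
  degS E S v = #|S :&: nbh E v|.
Proof.
move=> sE vS; rewrite /degS (card_edges_at (fun e => e \subset S) v sE).
apply: eq_card => w; rewrite !inE andbC; congr (_ && _).
by rewrite finset.subUset !finset.sub1set vS.
Qed.

End Neighbourhoods.

Section Switching.
Variables (n : nat) (dn : 'I_n -> nat).
Implicit Types (E F : {set {set 'I_n}}) (u v w x y : 'I_n).
Local Notation M := (Msum dn).
Local Notation D := (Dmax dn).

Definition gcount F : nat := #|[set E in graphs_deg dn | F \subset E]|.

Lemma graphs_degP E : reflect (simple_graph E /\ forall v, deg E v = dn v) (E \in graphs_deg dn).
Proof.
rewrite inE; apply: (iffP andP) => -[sE dE]; split=> //.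
  by move=> v; apply/eqP; apply: (forallP dE).
by apply/forallP => v; rewrite dE.
Qed.

Lemma card_nbh_deg E v : E \in graphs_deg dn -> #|nbh E v| = dn v.
Proof. by case/graphs_degP => sE dE; rewrite card_nbh. Qed.

Lemma le_Dmax v : (dn v <= D)%N.
Proof. exact: (leq_bigmax v). Qed.

Definition switch E u v x y :=
  [set [set u; x]; [set v; y]] :|: (E :\: [set [set u; v]; [set x; y]]).

(** Excluding the closed neighbourhoods ensures that ux and vy are neither loops nor already
    edges. *)
Definition switchable E u v x y :=
  [&& [set x; y] \in E, x \notin u |: nbh E u & y \notin v |: nbh E v].

(** Since uv is an edge, [x = v] would make [x] a neighbour of [u], and [y = u] would make [y] a
    neighbour of [v]. *)
Lemma switchable_uniq E u v x y : simple_graph E -> [set u; v] \in E ->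
  switchable E u v x y -> uniq [:: u; v; x; y].
Proof.
move=> sE uvE /and3P[xyE]; rewrite !inE !negb_or => /andP[xu xN] /andP[yv yN].
have uv := edge_neq sE uvE; have xy := edge_neq sE xyE.
have xv : x != v by apply: contraNneq xN => ->.
have yu : y != u by apply: contraNneq yN => ->; rewrite finset.setUC.
by rewrite /= !inE !negb_or uv xy (eq_sym u x) xu (eq_sym u y) yu (eq_sym v x) xv (eq_sym v y) yv.
Qed.

(** The pairs ux and vy were not edges of [E], so deleting them and restoring uv and xy undoes the
    switch; this gives injectivity in the double count. *)
Lemma switch_inv E u v x y : simple_graph E -> [set u; v] \in E ->
  switchable E u v x y ->
  E = [set [set u; v]; [set x; y]] :|:
      (switch E u v x y :\: [set [set u; x]; [set v; y]]).
Proof.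
move=> sE uvE sw; have /and3P[xyE] := sw.
rewrite !inE !negb_or => /andP[_ xN] /andP[_ yN].
apply/setP => e; rewrite !inE.
have [->|eab] := eqVneq e [set u; v]; first by rewrite uvE.
have [->|eab'] := eqVneq e [set x; y]; first by rewrite xyE.
have [->|] := eqVneq e [set u; x]; first by rewrite (negbTE xN).
by have [->|] := eqVneq e [set v; y]; first by rewrite (negbTE yN).
Qed.

Lemma deg_sum E z : deg E z = (\sum_(e in E) (z \in e))%N.
Proof.
rewrite /deg -sum1_card big_mkcond [RHS]big_mkcond /=; apply: eq_bigr => e _.
by rewrite inE; case: (e \in E); case: (z \in e).
Qed.

Lemma mem_set2_nat u v z : u != v -> ((z \in [set u; v]) : nat) = ((z == u) + (z == v))%N.
Proof.
move=> uv; rewrite !inE; case: eqP => [->|] //=.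
by rewrite (negbTE uv).
Qed.

(** Outside the common edge set [K], the removed pair of edges and the added pair each cover [u],
    [v], [x] and [y] exactly once. *)
Lemma switch_deg E u v x y z : simple_graph E -> [set u; v] \in E ->
  switchable E u v x y -> deg (switch E u v x y) z = deg E z.
Proof.
move=> sE uvE sw; have := switchable_uniq sE uvE sw.
rewrite /= !inE !negb_or andbT => /and3P[/and3P[uv ux uy] /andP[vx vy] xy].
have /and3P[xyE] := sw.
rewrite !inE !negb_or => /andP[_ uxE] /andP[_ vyE].
rewrite !deg_sum.
have ab : [set u; v] != [set x; y].
  by apply/eqP => /setP/(_ u); rewrite !inE eqxx (negbTE ux) (negbTE uy).
have cd : [set u; x] != [set v; y].
  by apply/eqP => /setP/(_ u); rewrite !inE eqxx (negbTE uv) (negbTE uy).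
have disj (a b : {set 'I_n}) (K : {set {set 'I_n}}) (f : {set 'I_n} -> nat) : a != b -> a \notin K -> b \notin K ->
    (\sum_(e in [set a; b] :|: K) f e = f a + f b + \sum_(e in K) f e)%N.
  move=> Hab aK bK; rewrite -finset.setUA big_setU1 /=; last by rewrite !inE negb_or Hab.
  by rewrite big_setU1 //= addnA.
set K := E :\: [set [set u; v]; [set x; y]].
have K1 : switch E u v x y :\: [set [set u; x]; [set v; y]] = K.
  apply/setP => e; rewrite !inE.
  have [->|_] := eqVneq e [set u; x]; first by rewrite (negbTE uxE) andbF.
  by have [->|_] := eqVneq e [set v; y]; first by rewrite (negbTE vyE) andbF.
rewrite [in RHS](switch_inv sE uvE sw) K1 /switch -/K.
rewrite !disj //; try by rewrite /K !finset.in_setD ?(negbTE uxE) ?(negbTE vyE) ?andbF // !inE !eqxx ?orbT.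
by rewrite !mem_set2_nat // addnACA.
Qed.

Lemma switch_graphs_deg E u v x y : E \in graphs_deg dn -> [set u; v] \in E ->
  switchable E u v x y -> switch E u v x y \in graphs_deg dn.
Proof.
move=> /graphs_degP[sE dE] uvE sw; apply/graphs_degP; split=> [|z]; last first.
  by rewrite switch_deg.
have := switchable_uniq sE uvE sw.
rewrite /= !inE !negb_or andbT => /and3P[/and3P[uv ux uy] /andP[vx vy] xy].
apply/forall_inP => e; rewrite !inE => /orP[/orP[] /eqP -> | /andP[_ eE]].
- by rewrite cards2 ux.
- by rewrite cards2 vy.
- exact: (forall_inP sE).
Qed.

(** There are [M] oriented edges xy. One is lost only if it orients an edge of [F] (two orientations
    each), starts in the closed neighbourhood of [u], or ends in that of [v]; each of the last two
    cases costs at most D(D+1). *)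
Lemma count_switchable E F u v : E \in graphs_deg dn -> F \subset E ->
  (M <= #|[set xy : 'I_n * 'I_n | switchable E u v xy.1 xy.2 && ([set xy.1; xy.2] \notin F)]|
      + (2 * #|F| + 2 * (D * D.+1)))%N.
Proof.
move=> EG FE; have [sE dE] := graphs_degP _ EG.
pose adj (xy : 'I_n * 'I_n) := [set xy.1; xy.2] \in E.
have sum_adj (P : pred 'I_n) : (\sum_xy (adj xy && P xy.1) = \sum_(x | P x) dn x)%N.
  rewrite -(pair_big xpredT xpredT (fun x y => ([set x; y] \in E) && P x : nat)) /=.
  rewrite [RHS]big_mkcond; apply: eq_bigr => x _; rewrite -(card_nbh_deg x EG) -sum1_card.
  case: (P x); last by rewrite big1 // => y _; rewrite andbF.
  rewrite [RHS]big_mkcond; apply: eq_bigr => y _.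
  by rewrite inE andbT; case: ifP.
have near w : (\sum_(x | x \in w |: nbh E w) dn x <= D * D.+1)%N.
  apply: (@leq_trans (\sum_(x in w |: nbh E w) D)); first by apply: leq_sum => x _; apply: le_Dmax.
  rewrite sum_nat_const mulnC leq_mul2l; apply/orP; right.
  by rewrite cardsU1 nbh_irr //= add1n ltnS card_nbh // dE le_Dmax.
have swap (P : pred 'I_n) : (\sum_xy (adj xy && P xy.2) = \sum_xy (adj xy && P xy.1))%N.
  have swapK : involutive (fun xy : 'I_n * 'I_n => (xy.2, xy.1)) by case.
  rewrite (reindex_inj (inv_inj swapK)) /=.
  by apply: eq_bigr => -[x y] _; rewrite /adj /= finset.setUC.
have inF : (\sum_(xy : 'I_n * 'I_n) ([set xy.1; xy.2] \in F) <= 2 * #|F|)%N.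
  apply: (@leq_trans (\sum_xy \sum_(f in F) (([set xy.1; xy.2] : {set 'I_n}) == f))).
    apply: leq_sum => xy _; case: (boolP (_ \in F)) => // xyF.
    by rewrite (bigD1 [set xy.1; xy.2]) //= eqxx.
  rewrite exchange_big mulnC -sum_nat_const /=; apply: leq_sum => f fF.
  have /cards2P [a [b [ab ->]]] := forall_inP sE _ (fintype.subsetP FE _ fF).
  apply: (@leq_trans #|[set (a, b); (b, a)]|); last by rewrite cards2; case: eqP.
  rewrite -sum1_card [leqRHS]big_mkcond /=; apply: leq_sum => -[x y] _ /=.
  case: eqP => // /setP exy; move: (exy a) (exy b) (exy x) (exy y).
  rewrite !inE !eqxx !orbT !xpair_eqE (eq_sym a x) (eq_sym a y) (eq_sym b x) (eq_sym b y).
  have not_both z : ~~ ((z == a) && (z == b)).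
    by apply: contraNN ab => /andP[/eqP <- /eqP <-].
  move: (not_both x) (not_both y).
  by case: (x == a); case: (x == b); case: (y == a); case: (y == b).
have -> : M = (\sum_xy adj xy)%N.
  rewrite /Msum -(sum_adj xpredT); apply: eq_bigr => xy _; by rewrite andbT.
apply: (@leq_trans (\sum_xy ((switchable E u v xy.1 xy.2 && ([set xy.1; xy.2] \notin F))
   + ([set xy.1; xy.2] \in F) + (adj xy && (xy.1 \in u |: nbh E u))
   + (adj xy && (xy.2 \in v |: nbh E v))))%N).
  apply: leq_sum => xy _; rewrite /switchable /adj.
  by do 4 case: (_ \in _).
rewrite !big_split /= (swap (mem (v |: nbh E v))).
rewrite (sum_adj (mem (v |: nbh E v))) (sum_adj (mem (u |: nbh E u))) /=.
have := near u; have := near v.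
rewrite -[in #|_|]sum1_card [in X in (_ <= X + _)%N]big_mkcond /=.
rewrite [X in (_ <= X + _)%N](eq_bigr (fun xy : 'I_n * 'I_n => (switchable E u v xy.1 xy.2 && ([set xy.1; xy.2] \notin F) : nat))).
  have add4 (a b c e f g : nat) : (b <= f -> e <= g -> c <= g -> a + b + c + e <= a + (f + 2 * g))%N.
    by lia.
  by apply: add4.
by move=> xy _; rewrite inE; case: ifP.
Qed.

(* Double counting: replace the edges uv and xy by ux and vy, for every switchable
   oriented edge xy; given x and y the switched graph determines the original. *)
Lemma switching F u v : [set u; v] \notin F ->
  (gcount ([set u; v] |: F) * (M - (2 * #|F| + 2 * (D * D.+1))) <=
   dn u * dn v * gcount F)%N.
Proof.
move=> uvF.
set G1 := [set E in graphs_deg dn | [set u; v] |: F \subset E].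
set G0 := [set E in graphs_deg dn | F \subset E].
pose X := [set t : {set {set 'I_n}} * ('I_n * 'I_n) | (t.1 \in G1) &&
  (switchable t.1 u v t.2.1 t.2.2 && ([set t.2.1; t.2.2] \notin F))].
pose Y := [set t : {set {set 'I_n}} * ('I_n * 'I_n) | (t.1 \in G0) &&
  ((t.2.1 \in nbh t.1 u) && (t.2.2 \in nbh t.1 v))].
pose phi (t : {set {set 'I_n}} * ('I_n * 'I_n)) := (switch t.1 u v t.2.1 t.2.2, t.2).
have card_triples (G : {set {set {set 'I_n}}}) (P : {set {set 'I_n}} -> pred ('I_n * 'I_n)) :
    #|[set t : {set {set 'I_n}} * ('I_n * 'I_n) | (t.1 \in G) && P t.1 t.2]|
    = (\sum_(E in G) #|[set xy | P E xy]|)%N.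
  rewrite -sum1_card (eq_bigl (fun t => (t.1 \in G) && P t.1 t.2)); last by move=> t; rewrite inE.
  rewrite -(pair_big_dep (mem G) P (fun _ _ => 1%N)) /=.
  by apply: eq_bigr => E _; rewrite -sum1_card; apply: eq_bigl => xy; rewrite inE.
have XY : (#|X| <= #|Y|)%N.
  rewrite -(card_in_imset (f := phi)) => [|[E1 [x1 y1]] [E2 [x2 y2]]].
    apply: subset_leq_card; apply/fintype.subsetP => _ /imsetP[[E [x y]] + ->].
    rewrite [_ \in X]finset.in_set [_ \in Y]finset.in_set /= [E \in G1]finset.in_set.
    rewrite finset.subUset finset.sub1set => /and3P[/and3P[EG uvE FE] sw xyF].
    rewrite [_ \in G0]finset.in_set switch_graphs_deg //= !inE !eqxx ?orbT !andbT.
    (* The edges of [F] survive the switch because neither deleted edge, uv or xy, belongs to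
       [F]. *)
    apply/fintype.subsetP => f fF; rewrite !inE (fintype.subsetP FE _ fF) andbT.
    have -> : f == [set u; v] = false by apply: contraNF uvF => /eqP <-.
    have -> : f == [set x; y] = false by apply: contraNF xyF => /eqP <-.
    by rewrite orbT.
  rewrite ![_ \in X]finset.in_set /= ![_ \in G1]finset.in_set !finset.subUset !finset.sub1set.
  move=> /and3P[/and3P[/graphs_degP[sE1 _] uvE1 _] sw1 _].
  move=> /and3P[/and3P[/graphs_degP[sE2 _] uvE2 _] sw2 _] [eE ex ey].
  subst x2 y2; congr (_, _).
  by rewrite (switch_inv sE1 uvE1 sw1) (switch_inv sE2 uvE2 sw2) eE.
(* For each graph in [G0] the admissible pairs form the product of the neighbourhoods of [u] and
   [v]. *)
have -> : (dn u * dn v * gcount F = #|Y|)%N.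
  rewrite /Y (card_triples G0 (fun E xy => (xy.1 \in nbh E u) && (xy.2 \in nbh E v))).
  rewrite /gcount -/G0 mulnC -sum_nat_const; apply: eq_bigr => E.
  rewrite [_ \in G0]finset.in_set => /andP[EG _]; rewrite -(card_nbh_deg u EG) -(card_nbh_deg v EG) -cardsX.
  by apply: eq_card => xy; rewrite !inE.
apply: leq_trans XY.
rewrite /X (card_triples G1 (fun E xy => switchable E u v xy.1 xy.2 && ([set xy.1; xy.2] \notin F))).
rewrite /gcount -/G1 -sum_nat_const; apply: leq_sum => E.
rewrite [_ \in G1]finset.in_set finset.subUset => /and3P[EG _ FE].
by rewrite leq_subLR addnC; apply: count_switchable.
Qed.

End Switching.

(** * Edge and common-neighbour probabilities *)

Section GraphAverage.
Variables (R : realType) (n : nat) (dn : 'I_n -> nat).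
Implicit Types (E F : {set {set 'I_n}}) (u v w : 'I_n) (f g : {set {set 'I_n}} -> R).
Local Notation M := ((Msum dn)%:R : R).
Local Notation D := ((Dmax dn)%:R : R).

Definition gavg f : R := (#|graphs_deg dn|%:R)^-1 * \sum_(E in graphs_deg dn) f E.

Lemma gavg_le f g : (forall E, E \in graphs_deg dn -> f E <= g E) -> gavg f <= gavg g.
Proof. by move=> fg; rewrite ler_wpM2l ?invr_ge0 ?ler0n // ler_sum. Qed.

Lemma gavgD f g : gavg (fun E => f E + g E) = gavg f + gavg g.
Proof. by rewrite /gavg big_split mulrDr. Qed.

Lemma gavgZ c f : gavg (fun E => c * f E) = c * gavg f.
Proof. by rewrite /gavg -mulr_sumr mulrCA. Qed.

Lemma gavg_sum (I : Type) (r : seq I) (P : pred I) (f : I -> {set {set 'I_n}} -> R) :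
  gavg (fun E => \sum_(i <- r | P i) f i E) = \sum_(i <- r | P i) gavg (f i).
Proof. by rewrite /gavg exchange_big mulr_sumr. Qed.

Hypothesis graph_exists : (0 < #|graphs_deg dn|)%N.

Lemma gavg_cst c : gavg (fun=> c) = c.
Proof.
by rewrite /gavg sumr_const -[c *+ _]mulr_natl mulKf // pnatr_eq0 -lt0n.
Qed.

Definition eprob F : R := gavg (fun E => (F \subset E)%:R).

Lemma eprobE F : eprob F = (gcount dn F)%:R / #|graphs_deg dn|%:R.
Proof.
rewrite /eprob /gavg mulrC; congr (_ / _).
rewrite /gcount -sum1_card natr_sum big_mkcond [RHS]big_mkcond /=.
by apply: eq_bigr => E _; rewrite [X in _ = if X then _ else _]finset.in_set;
  case: (E \in _); case: (F \subset E).
Qed.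

Lemma eprob0 : eprob finset.set0 = 1.
Proof.
rewrite -[RHS](gavg_cst 1) /eprob; congr (_ * _).
by apply: eq_bigr => E _; rewrite finset.sub0set.
Qed.

Hypothesis M_large : (2 * (6 + 2 * (Dmax dn * (Dmax dn).+1)) <= Msum dn)%N.

Definition edge_bound u v : R := 2 * (dn u)%:R * (dn v)%:R / M.

Lemma edge_bound_ge0 u v : 0 <= edge_bound u v.
Proof. by rewrite divr_ge0 // ?mulr_ge0 ?ler0n. Qed.

Lemma Msum_gt0 : 0 < M.
Proof. by rewrite ltr0n; apply: leq_trans M_large. Qed.

(** With at most three edges in [F], [M_large] makes the loss in the switching count at most M/2,
    whence the factor 2 in [edge_bound]. Three suffices because the largest configuration needed, a
    4-cycle, is built edge by edge. *)
Lemma eprobU1 F u v : (#|F| <= 3)%N -> [set u; v] \notin F ->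
  eprob ([set u; v] |: F) <= edge_bound u v * eprob F.
Proof.
move=> F3 uvF; have := switching dn uvF.
set c := (2 * #|F| + _)%N => sw.
have cM : (2 * c <= Msum dn)%N by move: M_large; rewrite /c; lia.
rewrite !eprobE mulrA ler_wpM2r ?invr_ge0 ?ler0n //.
rewrite /edge_bound mulrAC ler_pdivlMr; last exact: Msum_gt0.
rewrite -!natrM ler_nat.
have : (gcount dn ([set u; v] |: F) * Msum dn <=
        gcount dn ([set u; v] |: F) * (2 * (Msum dn - c)))%N.
  by rewrite leq_mul2l; apply/orP; right; move: cM; lia.
move/leq_trans; apply; rewrite mulnCA -!mulnA leq_mul2l /=.
by rewrite !mulnA.
Qed.

Lemma eprob1 v w : eprob [set [set v; w]] <= edge_bound v w.
Proof.
rewrite -[leRHS]mulr1 -eprob0 -[X in eprob X]finset.setU0.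
by apply: eprobU1; rewrite ?cards0 ?inE.
Qed.

Lemma set2_neq (u v x y : 'I_n) : u != x -> u != y -> [set u; v] != [set x; y].
Proof.
by move=> ux uy; apply/eqP => /setP/(_ u); rewrite !inE eqxx (negbTE ux) (negbTE uy).
Qed.

Lemma eprob_path v w u : v != w -> u != v -> u != w ->
  eprob [set [set v; u]; [set w; u]] <= edge_bound v u * edge_bound w u.
Proof.
move=> vw uv uw; apply: (@le_trans _ _ (edge_bound v u * eprob [set [set w; u]])).
  by apply: eprobU1; rewrite ?cards1 ?inE // set2_neq // eq_sym.
by rewrite ler_wpM2l ?edge_bound_ge0 ?eprob1.
Qed.

Lemma eprob_triangle v w u : v != w -> u != v -> u != w ->
  eprob ([set v; w] |: [set [set v; u]; [set w; u]]) <=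
  edge_bound v w * (edge_bound v u * edge_bound w u).
Proof.
move=> vw uv uw.
apply: (@le_trans _ _ (edge_bound v w * eprob [set [set v; u]; [set w; u]])).
  apply: eprobU1; first by rewrite cards2; case: (_ != _).
  rewrite !inE negb_or [[set v; w] in X in X && _]finset.setUC !set2_neq // 1?eq_sym //.
by rewrite ler_wpM2l ?edge_bound_ge0 ?eprob_path.
Qed.

Lemma eprob_square v w u u' : v != w -> u != v -> u != w -> u' != v -> u' != w -> u != u' ->
  eprob ([set v; u] |: ([set w; u] |: [set [set v; u']; [set w; u']])) <=
  (edge_bound v u * edge_bound w u) * (edge_bound v u' * edge_bound w u').
Proof.
move=> vw uv uw u'v u'w uu'.
have c2 : (#|[set [set v; u']; [set w; u']]| <= 2)%N by rewrite cards2; case: (_ != _).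
rewrite -mulrA.
apply: (@le_trans _ _ (edge_bound v u * eprob ([set w; u] |: [set [set v; u']; [set w; u']]))).
  apply: eprobU1; first by rewrite cardsU1; exact: leq_add (leq_b1 _) c2.
  rewrite !inE !negb_or; apply/and3P; split; [|rewrite finset.setUC|];
    by rewrite set2_neq // eq_sym.
rewrite ler_wpM2l ?edge_bound_ge0 //.
apply: (@le_trans _ _ (edge_bound w u * eprob [set [set v; u']; [set w; u']])).
  apply: eprobU1; first exact: leq_trans c2 _.
  rewrite !inE !negb_or; apply/andP; split; [|rewrite finset.setUC];
    by rewrite set2_neq // eq_sym.
by rewrite ler_wpM2l ?edge_bound_ge0 ?eprob_path.
Qed.

(** * Overlaps of closed neighbourhoods *)

Definition cnbh E v := v |: nbh E v.

(** A common vertex is [v] or [w], which forces the edge vw, or a third vertex adjacent to both. *)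
Lemma common_cnbh_indicator E v w : simple_graph E -> v != w ->
  (cnbh E v :&: cnbh E w != finset.set0)%:R <=
  ([set [set v; w]] \subset E)%:R +
  \sum_(u | (u != v) && (u != w)) ([set [set v; u]; [set w; u]] \subset E)%:R :> R.
Proof.
move=> sE vw; case: set0Pn => [[u]|_]; last by rewrite addr_ge0 ?sumr_ge0.
rewrite !inE => /andP[/orP[/eqP->|vu]].
  rewrite (negbTE vw) /= finset.setUC => vwE.
  by rewrite finset.sub1set vwE lerDl sumr_ge0.
case/orP => [/eqP uw|wu].
  by rewrite finset.sub1set -uw vu lerDl sumr_ge0.
have uv := edge_neq sE vu; have uw := edge_neq sE wu.
rewrite (bigD1 u) /=; last by rewrite eq_sym uv eq_sym.
rewrite finset.subUset !finset.sub1set vu wu addrCA lerDl addr_ge0 ?sumr_ge0 //.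
Qed.

(** If vw is an edge, one of three common vertices lies outside {v, w} and closes a triangle. If
    not, no common vertex is [v] or [w], and two of them form a 4-cycle with [v] and [w]. *)
Lemma many_common_cnbh_indicator E v w : simple_graph E -> v != w ->
  (2 < #|cnbh E v :&: cnbh E w|)%N%:R <=
  \sum_(u | (u != v) && (u != w))
     (([set v; w] |: [set [set v; u]; [set w; u]]) \subset E)%:R +
  \sum_(u | (u != v) && (u != w)) \sum_(u' | [&& u' != v, u' != w & u != u'])
     (([set v; u] |: ([set w; u] |: [set [set v; u']; [set w; u']])) \subset E)%:R :> R.
Proof.
move=> sE vw; set K := _ :&: _.
case: ltnP => /= [K3|_]; last by rewrite addr_ge0 ?sumr_ge0 // => u _; rewrite sumr_ge0.
have outer u : u \in K -> u != v -> u != w -> ([set v; u] \in E) && ([set w; u] \in E).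
  by rewrite !inE => + uv uw; rewrite (negbTE uv) (negbTE uw).
have pair_sub u : u \in K -> u != v -> u != w -> [set [set v; u]; [set w; u]] \subset E.
  by move=> uK uv uw; have := outer u uK uv uw; rewrite finset.subUset !finset.sub1set.
have [vwE|vwE] := boolP ([set v; w] \in E).
  have : (0 < #|K :\: [set v; w]|)%N.
    rewrite lt0n; apply: contraTneq K3 => K0.
    rewrite -leqNgt -(cardsID [set v; w] K) K0 addn0.
    by apply: leq_trans (subset_leq_card (finset.subsetIr _ _)) _; rewrite cards2 vw.
  case/card_gt0P => u; rewrite !inE negb_or -andbA => /and3P[uv uw uK].
  rewrite (bigD1 u) /= ?uv ?uw // finset.subUset finset.sub1set vwE pair_sub //; last by rewrite !inE.
  by rewrite -addrA lerDl addr_ge0 ?sumr_ge0 // => u0 _; rewrite sumr_ge0.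
have vK u : u \in K -> (u != v) && (u != w).
  rewrite !inE => uK; apply/andP; split; apply: contraNneq vwE => uE; move: uK; rewrite uE.
    by rewrite (negbTE vw) eqxx /= finset.setUC.
  by rewrite eqxx andbT eq_sym (negbTE vw).
have [u uK] : exists u, u \in K by apply/card_gt0P; apply: leq_trans K3.
have [u' ] : exists u', u' \in K :\ u.
  apply/card_gt0P; rewrite lt0n; apply: contraTneq K3 => K0.
  by rewrite -leqNgt (cardsD1 u K) uK K0.
rewrite 2!inE => /andP[u'u u'K].
have [uv uw] := andP (vK _ uK); have [u'v u'w] := andP (vK _ u'K).
rewrite addrC (bigD1 u) /= ?uv ?uw // (bigD1 u') /= ?u'v ?u'w 1?eq_sym //.
have [vuE wuE] := andP (outer u uK uv uw).
rewrite (_ : _ |: _ \subset E = true); last first.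
  by rewrite !finset.subUset !finset.sub1set vuE wuE; case/andP: (outer u' u'K u'v u'w) => -> ->.
rewrite /= -!addrA lerDl !addr_ge0 ?sumr_ge0 // => u0 _; rewrite sumr_ge0 //.
Qed.

Lemma sum_degree_sq : \sum_u (dn u)%:R ^+ 2 <= D * M.
Proof.
rewrite /Msum natr_sum mulr_sumr; apply: ler_sum => u _.
by rewrite expr2 ler_wpM2r ?ler0n // ler_nat le_Dmax.
Qed.

Lemma sum_edge_bound v w (P : pred 'I_n) :
  \sum_(u | P u) edge_bound v u * edge_bound w u <= 4 * (dn v)%:R * (dn w)%:R * D / M.
Proof.
apply: (@le_trans _ _ (\sum_u edge_bound v u * edge_bound w u)).
  rewrite big_mkcond; apply: ler_sum => u _; case: ifP => // _.
  by rewrite mulr_ge0 ?edge_bound_ge0.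
have M0 := Msum_gt0.
rewrite (eq_bigr (fun u => 4 * (dn v)%:R * (dn w)%:R / M ^+ 2 * (dn u)%:R ^+ 2)); last first.
  by move=> u _; rewrite /edge_bound; field; rewrite lt0r_neq0.
rewrite -mulr_sumr.
have -> : 4 * (dn v)%:R * (dn w)%:R * D / M = 4 * (dn v)%:R * (dn w)%:R / M ^+ 2 * (D * M).
  by field; rewrite lt0r_neq0.
rewrite ler_wpM2l ?sum_degree_sq // divr_ge0 ?exprn_ge0 ?mulr_ge0 ?ler0n //.
Qed.

Hypothesis D_gt0 : (0 < Dmax dn)%N.

Lemma Dmax_ge1 : 1 <= D. Proof. by rewrite ler1n. Qed.

(** The edge vw contributes 2C^2/M and the paths 4C^2 D/M; [D >= 1] merges them into the constant
    6. *)
Lemma gavg_common_cnbh v w (C : R) : v != w -> (dn v)%:R <= C -> (dn w)%:R <= C ->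
  gavg (fun E => (cnbh E v :&: cnbh E w != finset.set0)%:R) <= 6 * C ^+ 2 * D / M.
Proof.
move=> vw vC wC; have M0 := Msum_gt0; have D1 := Dmax_ge1.
have dv0 : 0 <= (dn v)%:R :> R by rewrite ler0n.
have dw0 : 0 <= (dn w)%:R :> R by rewrite ler0n.
have dvw : (dn v)%:R * (dn w)%:R <= C ^+ 2 :> R by rewrite expr2 ler_pM.
apply: (@le_trans _ _ (edge_bound v w + \sum_(u | (u != v) && (u != w)) edge_bound v u * edge_bound w u)).
  apply: le_trans (gavg_le (g := fun E => ([set [set v; w]] \subset E)%:R +
    \sum_(u | (u != v) && (u != w)) ([set [set v; u]; [set w; u]] \subset E)%:R) _) _.
    by move=> E /graphs_degP[sE _]; apply: common_cnbh_indicator.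
  rewrite gavgD gavg_sum lerD ?eprob1 //; apply: ler_sum => u /andP[uv uw].
  exact: eprob_path.
apply: le_trans (lerD (lexx _) (sum_edge_bound _ _ _)) _.
rewrite /edge_bound -mulrDl ler_wpM2r ?invr_ge0 ?(ltW M0) //.
have h : (dn v)%:R * (dn w)%:R * D <= C ^+ 2 * D by rewrite ler_wpM2r // ltW // ltr0n.
have h' : (dn v)%:R * (dn w)%:R <= (dn v)%:R * (dn w)%:R * D by rewrite ler_peMr // mulr_ge0.
have -> : 6 * C ^+ 2 * D = 6 * (C ^+ 2 * D) by rewrite mulrA.
rewrite -(mulrA 2) -(mulrA 4) -(mulrA 4 _ D).
lra.
Qed.

(** Let [B] bound the sum over paths. Triangles contribute at most (2C^2 D/M)B and 4-cycles at most
    B^2, so the constant is 2 * 4 + 4 * 4 = 24. *)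
Lemma gavg_many_common_cnbh v w (C : R) : v != w -> (dn v)%:R <= C -> (dn w)%:R <= C ->
  gavg (fun E => (2 < #|cnbh E v :&: cnbh E w|)%N%:R) <= 24 * C ^+ 4 * D ^+ 2 / M ^+ 2.
Proof.
move=> vw vC wC; have M0 := Msum_gt0; have D1 := Dmax_ge1.
have dv0 : 0 <= (dn v)%:R :> R by rewrite ler0n.
have dw0 : 0 <= (dn w)%:R :> R by rewrite ler0n.
have dvw : (dn v)%:R * (dn w)%:R <= C ^+ 2 :> R by rewrite expr2 ler_pM.
have C0 : 0 <= C ^+ 2 by rewrite sqr_ge0.
pose B := 4 * C ^+ 2 * D / M.
have sumB (P : pred 'I_n) : \sum_(u | P u) edge_bound v u * edge_bound w u <= B.
  apply: le_trans (sum_edge_bound _ _ _) _; rewrite /B ler_wpM2r ?invr_ge0 ?(ltW M0) //.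
  by rewrite ler_wpM2r ?ler0n // -mulrA ler_wpM2l.
have B0 : 0 <= B by apply: le_trans (sumB xpred0); rewrite big_pred0.
apply: (@le_trans _ _ (edge_bound v w * B + B * B)).
  apply: le_trans (gavg_le (fun E EG => many_common_cnbh_indicator (graphs_degP _ _ EG).1 vw)) _.
  rewrite gavgD !gavg_sum; apply: lerD.
    apply: (@le_trans _ _ (\sum_(u | (u != v) && (u != w)) edge_bound v w * (edge_bound v u * edge_bound w u))).
      by apply: ler_sum => u /andP[uv uw]; apply: eprob_triangle.
    by rewrite -mulr_sumr ler_wpM2l ?edge_bound_ge0.
  apply: (@le_trans _ _ (\sum_(u | (u != v) && (u != w)) edge_bound v u * edge_bound w u * B)).
    apply: ler_sum => u /andP[uv uw]; rewrite gavg_sum.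
    apply: (@le_trans _ _ (\sum_(u' | [&& u' != v, u' != w & u != u'])
       edge_bound v u * edge_bound w u * (edge_bound v u' * edge_bound w u'))).
      by apply: ler_sum => u' /and3P[u'v u'w uu']; apply: eprob_square.
    by rewrite -mulr_sumr ler_wpM2l // mulr_ge0 ?edge_bound_ge0.
  by rewrite -mulr_suml ler_wpM2r.
have -> : 24 * C ^+ 4 * D ^+ 2 / M ^+ 2 = (2 * C ^+ 2 * D / M) * B + B * B.
  by rewrite /B; field; rewrite lt0r_neq0.
rewrite lerD2r ler_wpM2r // /edge_bound ler_wpM2r ?invr_ge0 ?(ltW M0) //.
rewrite -(mulrA 2) -(mulrA 2) ler_wpM2l //; apply: le_trans dvw _.
by rewrite ler_peMr.
Qed.

End GraphAverage.

(** * Variance of the degree counts *)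

Section DegreeCounts.
Variables (R : realType) (n : nat) (dn : 'I_n -> nat) (p : R).
Implicit Types (E : {set {set 'I_n}}) (u v w : 'I_n) (A S : {set 'I_n}) (i : nat).
Local Notation M := ((Msum dn)%:R : R).
Local Notation D := ((Dmax dn)%:R : R).

Definition degS_ind E i v A : R := ((v \in A) && (degS E A v == i))%:R.

Definition degS_prob i v : R := p * binpmf p (dn v) i.

Lemma degS_indE E i v A : simple_graph E ->
  degS_ind E i v A = ((v \in A) && (#|A :&: nbh E v| == i))%:R.
Proof.
by move=> sE; rewrite /degS_ind; case: (boolP (v \in A)) => // vA; rewrite degS_nbh.
Qed.

Lemma nS_sum E A i : (nS E A i)%:R = \sum_v degS_ind E i v A.
Proof.
rewrite /nS -sum1_card natr_sum big_mkcond /=; apply: eq_bigr => v _.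
by rewrite inE /degS_ind; case: ifP.
Qed.

Lemma degS_ind_depends E i v : simple_graph E -> depends_on (cnbh E v) (degS_ind E i v).
Proof.
move=> sE A; rewrite !degS_indE // -finset.setIA; rewrite [v \in A :&: _]inE setU11 andbT.
by rewrite (finset.setIidPr (finset.subsetUr _ _)).
Qed.

Lemma bexp_degS_ind E i v : E \in graphs_deg dn -> bexp p (degS_ind E i v) = degS_prob i v.
Proof.
move=> EG; have [sE _] := graphs_degP _ _ EG.
rewrite /degS_prob -(card_nbh_deg v EG) -(bexp_vertex_card_eq p i (nbh_irr v sE)).
by apply: eq_bexp => A; rewrite degS_indE.
Qed.

Lemma degS_ind_ge0 E i v A : 0 <= degS_ind E i v A.
Proof. exact: ler0n. Qed.

Lemma degS_ind_le1 E i v A : degS_ind E i v A <= 1.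
Proof. by rewrite /degS_ind; case: (_ && _). Qed.

Hypothesis p01 : 0 < p < 1.

Lemma degS_prob_ge0 i v : 0 <= degS_prob i v.
Proof. by rewrite mulr_ge0 ?binpmf_ge0 //; case/andP: p01 => /ltW. Qed.

Let Q : R := (p * (1 - p))^-1.

Let Q_ge0 : 0 <= Q.
Proof. by case/andP: p01 => p0 p1; rewrite invr_ge0 mulr_ge0 ?subr_ge0 // ltW. Qed.

(** Disjoint closed neighbourhoods give covariance at most 0. An overlap of one or two vertices
    costs at most [Q ^+ 2], as [Q >= 1]. For a larger overlap the joint probability is bounded by
    that of the event of [v] alone. *)
Lemma degS_ind_covariance E i v w : E \in graphs_deg dn ->
  bexp p (fun A => degS_ind E i v A * degS_ind E i w A) - degS_prob i v * degS_prob i w <=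
  degS_prob i v * degS_prob i w * Q ^+ 2 * (cnbh E v :&: cnbh E w != finset.set0)%:R +
  degS_prob i v * (2 < #|cnbh E v :&: cnbh E w|)%N%:R.
Proof.
move=> EG; have [sE _] := graphs_degP _ _ EG.
set K := _ :&: _; set av := degS_prob i v; set aw := degS_prob i w.
have av0 : 0 <= av := degS_prob_ge0 i v; have aw0 : 0 <= aw := degS_prob_ge0 i w.
have avw0 : 0 <= av * aw by rewrite mulr_ge0.
have Q1 : 1 <= Q.
  case/andP: p01 => p0 p1; rewrite /Q invf_ge1 ?mulr_gt0 ?subr_gt0 //.
  by rewrite -[leRHS]mulr1 ler_pM ?subr_ge0 ?ltW //; lra.
have joint : bexp p (fun A => degS_ind E i v A * degS_ind E i w A) <= Q ^+ #|K| * (av * aw).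
  have := bexp_mul_le p01 (degS_ind_depends i v sE) (degS_ind_depends i w sE)
    (degS_ind_ge0 E i v) (degS_ind_ge0 E i w).
  by rewrite !bexp_degS_ind.
have [K3|K2] := ltnP 2 #|K|.
  apply: (@le_trans _ _ av).
    rewrite lerBlDr; apply: (@le_trans _ _ av); last by rewrite lerDl.
    rewrite /av -(bexp_degS_ind i v EG); apply: bexp_le => // A.
    by rewrite ler_piMr ?degS_ind_ge0 ?degS_ind_le1.
  by rewrite mulr1 lerDr; apply: mulr_ge0; [apply: mulr_ge0 (sqr_ge0 Q) | exact: ler0n].
rewrite /= mulr0 addr0; case: eqP joint => [-> | /eqP K0] joint.
  by rewrite mulr0 lerBlDr add0r; move: joint; rewrite cards0 expr0 mul1r.
rewrite mulr1 lerBlDr; apply: le_trans joint _.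
rewrite mulrC; apply: (@le_trans _ _ (av * aw * Q ^+ 2)); last by rewrite lerDl.
by rewrite ler_wpM2l // ler_weXn2l.
Qed.

Variable C : R.
Hypothesis C_ge0 : 0 <= C.
Hypothesis graph_exists : (0 < #|graphs_deg dn|)%N.
Hypothesis M_large : (2 * (6 + 2 * (Dmax dn * (Dmax dn).+1)) <= Msum dn)%N.
Hypothesis D_gt0 : (0 < Dmax dn)%N.
Hypothesis n_le_M : (n <= Msum dn)%N.

Definition low_mean i : R := \sum_(v | (dn v)%:R <= C) degS_prob i v.

Definition low_deviation E i A : R :=
  \sum_(v | (dn v)%:R <= C) degS_ind E i v A - low_mean i.

Lemma low_mean_ge0 i : 0 <= low_mean i.
Proof. by apply: sumr_ge0 => v _; apply: degS_prob_ge0. Qed.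

(** The mean given [E] is [low_mean] for every graph, so the second moment is a sum of covariances
    given [E], with no extra term for the variation of the mean over [E]. *)
Lemma bexp_low_deviation_sq E i : E \in graphs_deg dn ->
  bexp p (fun A => low_deviation E i A ^+ 2) =
  \sum_(v | (dn v)%:R <= C) \sum_(w | (dn w)%:R <= C)
    (bexp p (fun A => degS_ind E i v A * degS_ind E i w A) - degS_prob i v * degS_prob i w).
Proof.
move=> EG.
rewrite (eq_bexp (g := fun A => \sum_(v | (dn v)%:R <= C) \sum_(w | (dn w)%:R <= C)
   (degS_ind E i v A - degS_prob i v) * (degS_ind E i w A - degS_prob i w))); last first.
  move=> A; rewrite /low_deviation /low_mean -sumrB expr2 mulr_suml.
  by apply: eq_bigr => v _; rewrite mulr_sumr.
rewrite bexp_sum; apply: eq_bigr => v _; rewrite bexp_sum; apply: eq_bigr => w _.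
rewrite (eq_bexp (g := fun A => degS_ind E i v A * degS_ind E i w A
   - degS_prob i w * degS_ind E i v A - degS_prob i v * degS_ind E i w A
   + degS_prob i v * degS_prob i w)); last by move=> A; ring.
by rewrite bexpD !bexpB 2!bexpZ bexp_cst !bexp_degS_ind //; ring.
Qed.

Lemma variance_le i :
  gavg dn (fun E => bexp p (fun A => low_deviation E i A ^+ 2)) <=
  low_mean i * (1 + 24 * C ^+ 4 * D ^+ 2 / M) +
  low_mean i ^+ 2 * (Q ^+ 2 * (6 * C ^+ 2 * D / M)).
Proof.
have M0 : 0 < M by apply: Msum_gt0.
pose B1 := 6 * C ^+ 2 * D / M; pose B2 := 24 * C ^+ 4 * D ^+ 2 / M ^+ 2.
have B10 : 0 <= B1 by rewrite divr_ge0 ?mulr_ge0 ?sqr_ge0 ?ler0n.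
have B20 : 0 <= B2 by rewrite divr_ge0 ?mulr_ge0 ?exprn_ge0 ?ler0n.
(* On the diagonal the square of an indicator is bounded by the indicator; elsewhere the covariance
   bound applies. *)
pose bnd E v w : R := if v == w then degS_prob i v else
  degS_prob i v * degS_prob i w * Q ^+ 2 * (cnbh E v :&: cnbh E w != finset.set0)%:R +
  degS_prob i v * (2 < #|cnbh E v :&: cnbh E w|)%N%:R.
apply: (@le_trans _ _ (gavg dn (fun E => \sum_(v | (dn v)%:R <= C) \sum_(w | (dn w)%:R <= C) bnd E v w))).
  apply: gavg_le => E EG; rewrite bexp_low_deviation_sq //.
  apply: ler_sum => v _; apply: ler_sum => w _; rewrite /bnd.
  case: eqP => [<-|_]; last exact: degS_ind_covariance.
  rewrite lerBlDr -(bexp_degS_ind i v EG).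
  apply: (@le_trans _ _ (bexp p (degS_ind E i v))).
    by apply: bexp_le => // A; rewrite ler_piMr ?degS_ind_ge0 ?degS_ind_le1.
  by rewrite lerDl mulr_ge0 ?bexp_degS_ind ?degS_prob_ge0.
rewrite gavg_sum.
(* Adding nonnegative terms for [w = v] lets the inner sum run over all low-degree vertices, so that
   it factors. *)
apply: (@le_trans _ _ (\sum_(v | (dn v)%:R <= C) (degS_prob i v +
    \sum_(w | (dn w)%:R <= C) (degS_prob i v * degS_prob i w * Q ^+ 2 * B1 + degS_prob i v * B2)))).
  apply: ler_sum => v vC; rewrite gavg_sum (bigD1 v) //= [X in _ + X <= _]big_mkcondr /=.
  rewrite [X in _ <= _ + X](bigD1 v) //= addrA.
  have -> : gavg dn (fun E => bnd E v v) = degS_prob i v.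
    by rewrite -[RHS](gavg_cst (dn := dn)) //; congr (_ * _); apply: eq_bigr => E _; rewrite /bnd eqxx.
  rewrite -big_mkcondr /=; apply: lerD.
    rewrite lerDl; apply: addr_ge0; apply: mulr_ge0 => //; last exact: degS_prob_ge0.
    by apply: mulr_ge0 (sqr_ge0 Q); rewrite mulr_ge0 ?degS_prob_ge0.
  apply: ler_sum => w /andP[wC wv].
  rewrite /gavg (eq_bigr (fun E : {set {set 'I_n}} =>
     degS_prob i v * degS_prob i w * Q ^+ 2 * (cnbh E v :&: cnbh E w != finset.set0)%:R +
     degS_prob i v * (2 < #|cnbh E v :&: cnbh E w|)%N%:R)); last first.
    by move=> E _; rewrite /bnd eq_sym (negbTE wv).
  rewrite -/(gavg dn _) gavgD !gavgZ; apply: lerD; apply: ler_wpM2l.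
  - by apply: mulr_ge0 (sqr_ge0 Q); rewrite mulr_ge0 ?degS_prob_ge0.
  - by apply: gavg_common_cnbh => //; rewrite eq_sym.
  - exact: degS_prob_ge0.
  - by apply: gavg_many_common_cnbh => //; rewrite eq_sym.
rewrite big_split /= -/(low_mean i) mulrDr mulr1 -addrA lerD2l.
rewrite (eq_bigr (fun v => degS_prob i v * (low_mean i * Q ^+ 2 * B1) +
   degS_prob i v * (\sum_(w | (dn w)%:R <= C) B2))); last first.
  move=> v _; rewrite big_split /= -mulr_sumr; congr (_ + _).
  by rewrite -mulr_suml -mulr_suml -mulr_sumr !mulrA.
have : \sum_(w | (dn w)%:R <= C) B2 <= 24 * C ^+ 4 * D ^+ 2 / M.
  apply: (@le_trans _ _ (\sum_(w < n) B2)).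
    by rewrite [leLHS]big_mkcond; apply: ler_sum => w _; case: ifP.
  (* At most [n <= M] choices of [w] cancel one power of [M] in [B2]. *)
  rewrite sumr_const card_ord -[_ *+ _]mulr_natl.
  have -> : 24 * C ^+ 4 * D ^+ 2 / M = M * B2 by rewrite /B2; field; rewrite lt0r_neq0.
  by rewrite ler_wpM2r // ler_nat.
move: (\sum_(w | _) B2) => S2 S2_le.
rewrite big_split -!mulr_suml -/(low_mean i) /= addrC; apply: lerD; last first.
  by rewrite expr2 !mulrA.
by rewrite ler_wpM2l ?low_mean_ge0.
Qed.

End DegreeCounts.

(** * Numerical estimates *)

Section Numerics.
Variables (R : realType) (s p L M D C : R).
Hypothesis s_gt0 : 0 < s.
Hypothesis s_le : s <= 2 / 27.
Hypothesis p01 : 0 < p < 1.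
Hypothesis L_ge2 : 2 <= L.
Hypothesis M_gt0 : 0 < M.
Hypothesis D_ge1 : 1 <= D.
Hypothesis C_def : C * (s ^+ 4 * p) = L.
Hypothesis sparse : D ^+ 2 * L ^+ 12 <= s ^+ 64 * p ^+ 13 * M.

Let p_gt0 : 0 < p. Proof. by case/andP: p01. Qed.
Let p_le1 : p <= 1. Proof. by case/andP: p01 => _ /ltW. Qed.
Let L_gt0 : 0 < L. Proof. by have := L_ge2; lra. Qed.
Let L_ge1 : 1 <= L. Proof. by have := L_ge2; lra. Qed.
Let s_le1 : s <= 1. Proof. by have := s_le; lra. Qed.

Lemma expr_le1_prod k l : s ^+ k * p ^+ l <= 1.
Proof. by rewrite mulr_ile1 ?exprn_ge0 ?exprn_ile1 // ltW. Qed.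

Lemma ln_le_pC : L <= p * C.
Proof.
have C0 : 0 <= p * C.
  have h : 0 < s ^+ 4 * p by rewrite mulr_gt0 ?exprn_gt0.
  by rewrite mulr_ge0 ?(ltW p_gt0) // -(pmulr_lge0 _ h) C_def ltW.
rewrite -C_def mulrCA (mulrC p) ler_piMl //; first by rewrite mulrC.
by rewrite exprn_ile1 // ltW.
Qed.

Lemma ln_le_C : L <= C.
Proof.
apply: le_trans ln_le_pC _; rewrite ler_piMl //.
by have := lt_le_trans L_gt0 ln_le_pC; rewrite pmulr_rgt0 // => /ltW.
Qed.

Lemma C_gt0 : 0 < C. Proof. exact: lt_le_trans L_gt0 ln_le_C. Qed.

Lemma p_div_C3_le1 : p / C ^+ 3 <= 1.
Proof.
rewrite ler_pdivrMr ?exprn_gt0 ?C_gt0 // mul1r; apply: le_trans p_le1 _.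
by rewrite exprn_ege1 // (le_trans L_ge1 ln_le_C).
Qed.

Lemma sqrt_L_le : Num.sqrt L <= L.
Proof.
rewrite -{2}(sqr_sqrtr (ltW L_gt0)) expr2 ler_peMr ?sqrtr_ge0 //.
by rewrite -[leLHS]sqrtr1 ler_wsqrtr.
Qed.

Definition slack : R := p * C ^+ 6 / Num.sqrt L.

Lemma sqrt_L_gt0 : 0 < Num.sqrt L. Proof. by rewrite sqrtr_gt0. Qed.

(** Half of the slack must cover an error of 3 in [degree_count_close]: rounding, the mean from high
    degrees, and passing from [low_mean] to [nA] in the relative term, each at most 1. *)
Lemma slack_ge6 : 6 <= slack.
Proof.
rewrite /slack ler_pdivlMr ?sqrt_L_gt0 //.
apply: (@le_trans _ _ (6 * L)); first by rewrite ler_wpM2l // sqrt_L_le.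
have C2 : 2 <= C := le_trans L_ge2 ln_le_C.
have C5 : 6 <= C ^+ 5.
  apply: (@le_trans _ _ (2 ^+ 5)); last by apply: lerXn2r; rewrite ?nnegrE // ltW // C_gt0.
  by rewrite !exprS expr0; lra.
rewrite exprS mulrA mulrC; apply: ler_pM => //; [exact: ltW | exact: ln_le_pC].
Qed.

(** Multiplying by (s^4 p)^4 turns C^4 into L^4; [sparse] then applies, the surplus powers of [s]
    and [p] being at most 1. This controls the linear part of the variance. *)
Lemma C4D2_le : C ^+ 4 * D ^+ 2 <= M.
Proof.
have h : 0 < (s ^+ 4 * p) ^+ 4 by rewrite exprn_gt0 // mulr_gt0 ?exprn_gt0.
rewrite -(ler_pM2r h) mulrAC -exprMn C_def.
apply: (@le_trans _ _ (D ^+ 2 * L ^+ 12)).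
  by rewrite mulrC ler_wpM2l ?sqr_ge0 // ler_weXn2l.
apply: le_trans sparse _.
have -> : s ^+ 64 * p ^+ 13 * M = M * (s ^+ 4 * p) ^+ 4 * (s ^+ 48 * p ^+ 9) by ring.
by rewrite ler_piMr ?expr_le1_prod // mulr_ge0 // ltW.
Qed.

(** Here the multiplier is (s^4 p)^9, which uses L^10 and twelve of the thirteen powers of [p] in
    [sparse]. This controls the quadratic part of the variance. *)
Lemma C9D_le : C ^+ 9 * D * L <= p ^+ 3 * M.
Proof.
have h : 0 < (s ^+ 4 * p) ^+ 9 by rewrite exprn_gt0 // mulr_gt0 ?exprn_gt0.
rewrite -(ler_pM2r h).
have -> : C ^+ 9 * D * L * (s ^+ 4 * p) ^+ 9 = (C * (s ^+ 4 * p)) ^+ 9 * L * D by ring.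
rewrite C_def -exprSr.
apply: (@le_trans _ _ (D ^+ 2 * L ^+ 12)).
  rewrite mulrC; apply: ler_pM; rewrite ?exprn_ge0 ?(ltW L_gt0) ?(le_trans ler01) //.
    by rewrite expr2 ler_peMr // (le_trans ler01).
  by rewrite ler_weXn2l.
apply: le_trans sparse _.
have -> : s ^+ 64 * p ^+ 13 * M = p ^+ 3 * M * (s ^+ 4 * p) ^+ 9 * (s ^+ 28 * p ^+ 1) by ring.
by rewrite ler_piMr ?expr_le1_prod // !mulr_ge0 ?exprn_ge0 ?mulr_ge0 ?exprn_ge0 // ltW.
Qed.

Lemma DL_sq_le : (D * L) ^+ 2 <= p ^+ 10 * M.
Proof.
apply: (@le_trans _ _ (D ^+ 2 * L ^+ 12)).
  by rewrite exprMn ler_wpM2l ?sqr_ge0 // ler_weXn2l.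
apply: le_trans sparse _.
have -> : s ^+ 64 * p ^+ 13 * M = p ^+ 10 * M * (s ^+ 64 * p ^+ 3) by ring.
by rewrite ler_piMr ?expr_le1_prod // mulr_ge0 ?exprn_ge0 // ltW.
Qed.

(** The constant 20 is what [M_large] needs: 12 + 4D(D+1) <= 20D^2 for D >= 1. *)
Lemma D2_le : 20 * D ^+ 2 <= M.
Proof.
have h : D ^+ 2 <= s ^+ 2 * M.
  apply: (@le_trans _ _ (D ^+ 2 * L ^+ 12)).
    by rewrite ler_peMr ?sqr_ge0 // exprn_ege1.
  apply: le_trans sparse _.
  have -> : s ^+ 64 * p ^+ 13 * M = s ^+ 2 * M * (s ^+ 62 * p ^+ 13) by ring.
  by rewrite ler_piMr ?expr_le1_prod // mulr_ge0 ?exprn_ge0 // ltW.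
have : s ^+ 2 * M <= (2 / 27) ^+ 2 * M.
  by rewrite ler_wpM2r ?(ltW M_gt0) //; apply: lerXn2r; rewrite ?nnegrE ?(ltW s_gt0).
by move: h M_gt0; rewrite [(2 / 27) ^+ 2]expr2; lra.
Qed.

(** Only half of the slack is spent on random fluctuation; the other half absorbs the deterministic
    errors. *)
Definition tolerance (mu : R) : R := p * mu / C ^+ 3 + slack / 2.

Lemma tolerance_gt0 mu : 0 <= mu -> 0 < tolerance mu.
Proof.
move=> mu0; have := slack_ge6; have : 0 <= p * mu / C ^+ 3.
  by rewrite divr_ge0 ?mulr_ge0 ?exprn_ge0 // ltW // C_gt0.
by rewrite /tolerance; lra.
Qed.

(* [tolerance mu ^+ 2] is at least four times the product of its two terms, which
   handles the part of the variance linear in mu, and at least the square of the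
   first one, which handles the quadratic part. *)
Lemma chebyshev_ratio eps mu : 0 < eps -> p < 1 - eps -> 0 <= mu ->
  p * C * ((mu * (1 + 24 * C ^+ 4 * D ^+ 2 / M) +
    mu ^+ 2 * ((p * (1 - p))^-1 ^+ 2 * (6 * C ^+ 2 * D / M))) / tolerance mu ^+ 2)
  <= (13 + 6 / eps ^+ 2) / L.
Proof.
move=> eps0 peps mu0; have t0 := tolerance_gt0 mu0; have C0 := C_gt0.
have t20 : 0 < tolerance mu ^+ 2 by rewrite exprn_gt0.
set a := p * mu / C ^+ 3; set y := slack.
have a0 : 0 <= a by rewrite divr_ge0 ?mulr_ge0 ?exprn_ge0 // ltW.
have y0 : 0 <= y by have := slack_ge6; rewrite -/y; lra.
have t2a : 2 * a * y <= tolerance mu ^+ 2.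
  rewrite -subr_ge0 (_ : _ - _ = (a - y / 2) ^+ 2) ?sqr_ge0 //.
  by rewrite /tolerance -/a -/y; field.
have t2b : a ^+ 2 <= tolerance mu ^+ 2.
  by apply: lerXn2r; rewrite ?nnegrE ?(ltW t0) // /tolerance -/a -/y; lra.
(* The bracket is at most 1 + 24 = 25, and 2 * 13 = 26 exceeds it, which explains the 13. *)
have lin : p * C * (mu * (1 + 24 * C ^+ 4 * D ^+ 2 / M)) <= 13 / L * tolerance mu ^+ 2.
  apply: (@le_trans _ _ (p * C * (mu * 25))).
    have : C ^+ 4 * D ^+ 2 / M <= 1 by rewrite ler_pdivrMr // mul1r C4D2_le.
    rewrite -(mulrA 24) -(mulrA 24) => h.
    by apply: ler_wpM2l; [rewrite mulr_ge0 // ltW | apply: ler_wpM2l => //; lra].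
  apply: (@le_trans _ _ (13 / L * (2 * a * y))); last by rewrite ler_wpM2l // divr_ge0 // ltW.
  rewrite /a /y /slack.
  have -> : 13 / L * (2 * (p * mu / C ^+ 3) * (p * C ^+ 6 / Num.sqrt L)) =
     p * C * mu * (26 * ((p * C) * C / (L * Num.sqrt L))).
    by field; rewrite !lt0r_neq0 ?sqrt_L_gt0.
  rewrite [leLHS]mulrA; apply: ler_wpM2l; first by rewrite !mulr_ge0 // ltW.
  have : 1 <= p * C * C / (L * Num.sqrt L).
    rewrite ler_pdivlMr ?mul1r ?mulr_gt0 ?sqrt_L_gt0 //.
    apply: ler_pM; rewrite ?sqrtr_ge0 ?(ltW L_gt0) ?ln_le_pC //.
    exact: le_trans sqrt_L_le ln_le_C.
  lra.
have quad : p * C * (mu ^+ 2 * ((p * (1 - p))^-1 ^+ 2 * (6 * C ^+ 2 * D / M))) <=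
    6 / eps ^+ 2 / L * tolerance mu ^+ 2.
  apply: (@le_trans _ _ (6 / eps ^+ 2 / L * a ^+ 2)); last first.
    by rewrite ler_wpM2l // !divr_ge0 ?sqr_ge0 // ltW.
  apply: (@le_trans _ _ (p * C * (mu ^+ 2 * ((p * eps)^-1 ^+ 2 * (6 * C ^+ 2 * D / M))))).
    have q0 : 0 < 1 - p by case/andP: p01; rewrite subr_gt0.
    rewrite ler_wpM2l ?mulr_ge0 ?(ltW p_gt0) ?(ltW C0) // ler_wpM2l ?sqr_ge0 //.
    apply: ler_wpM2r.
      by rewrite divr_ge0 ?(ltW M_gt0) // mulr_ge0 ?(le_trans ler01 D_ge1) // mulr_ge0 ?sqr_ge0.
    apply: lerXn2r; rewrite ?nnegrE ?invr_ge0 ?mulr_ge0 ?(ltW p_gt0) ?(ltW q0) ?(ltW eps0) //.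
    by rewrite lef_pV2 ?posrE ?mulr_gt0 // ler_wpM2l ?(ltW p_gt0) //; lra.
  have -> : p * C * (mu ^+ 2 * ((p * eps)^-1 ^+ 2 * (6 * C ^+ 2 * D / M))) =
     6 / eps ^+ 2 / L * a ^+ 2 * (C ^+ 9 * D * L / (p ^+ 3 * M)).
    by rewrite /a; field; rewrite !lt0r_neq0.
  rewrite ler_piMr //; first by rewrite mulr_ge0 ?divr_ge0 ?sqr_ge0 ?(ltW L_gt0).
  by rewrite ler_pdivrMr ?mul1r ?C9D_le // mulr_gt0 ?exprn_gt0.
rewrite mulrA ler_pdivrMr // (mulrDr (p * C)) (mulrDl 13) (mulrDl (13 / L)).
exact: lerD.
Qed.

End Numerics.

(** * The estimate for a fixed number of vertices *)

Lemma sqr_lt_norm_le (R : realDomainType) (x y : R) : 0 <= y -> x ^+ 2 < y ^+ 2 -> `|x| <= y.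
Proof.
move=> y0; rewrite -real_normK ?num_real // => xy.
by rewrite leNgt; apply: contraTN xy => yx; rewrite -leNgt; apply: lerXn2r; rewrite ?nnegrE // ltW.
Qed.

(** * Rounding error in the model degree sequence *)

Section DegreeDistribution.
Variables (R : realType) (n : nat) (dn : 'I_n -> nat) (p : R).

Lemma floor_half_dist (x : R) : `| (Num.floor (x + 2^-1))%:~R - x | <= 2^-1.
Proof.
have /andP[] := floor_itv (x + 2^-1); rewrite intrD /= => h1 h2.
by rewrite ler_norml; apply/andP; split; lra.
Qed.

(** Each [Ntilde] is within 1/2 of the sum that it rounds, so a difference of two is within 1; for
    [i = 0] there is just one rounding. *)
Lemma nA_dist i : `| (nA dn p i)%:~R - p * \sum_v binpmf p (dn v) i | <= 1.
Proof.
have cdfS j k : binom_cdf j k.+1 p = binom_cdf j k p + binpmf p j k.+1.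
  by rewrite /binom_cdf big_ord_recr.
have Nt k := floor_half_dist (p * \sum_(v < n) binom_cdf (dn v) k p).
rewrite /nA /Ntilde; case: i => [|i].
  rewrite subr0; apply: le_trans (_ : 2^-1 <= 1); last by lra.
  apply: le_trans (Nt 0%N); rewrite le_eqVlt; apply/orP; left; apply/eqP.
  congr (`| _ - p * _ |); apply: eq_bigr => v _.
  by rewrite /binom_cdf big_ord_recl big_ord0 addr0.
have := Nt i; have := Nt i.+1; rewrite intrB.
have -> : \sum_(v < n) binom_cdf (dn v) i.+1 p =
   \sum_(v < n) binom_cdf (dn v) i p + \sum_(v < n) binpmf p (dn v) i.+1.
  by rewrite -big_split; apply: eq_bigr => v _; rewrite cdfS.
rewrite mulrDr !ler_norml => /andP[h1 h2] /andP[h3 h4].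
by apply/andP; split; lra.
Qed.

End DegreeDistribution.

Section FixedSize.
Variables (R : realType) (n : nat) (dn : 'I_n -> nat) (p delta eps : R).
Local Notation M := ((Msum dn)%:R : R).
Local Notation D := ((Dmax dn)%:R : R).
Local Notation L := (ln M).
Local Notation C := (Cp delta p M).
Let s : R := delta `^ (64%:R)^-1.

Hypothesis n_ge2 : (2 <= n)%N.
Hypothesis dn_ge1 : forall v, (1 <= dn v)%N.
Hypothesis p01 : 0 < p < 1.
Hypothesis eps_gt0 : 0 < eps.
Hypothesis p_lt : p < 1 - eps.
Hypothesis delta_gt0 : 0 < delta.
Hypothesis s_le : s <= 2 / 27.
Hypothesis L_ge2 : 2 <= L.
Hypothesis graph_exists : (0 < #|graphs_deg dn|)%N.
Hypothesis sparse : D ^+ 2 * p ^- 12 * L ^+ 12 <= delta * p * M.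

Let p_gt0 : 0 < p. Proof. by case/andP: p01. Qed.
Let s_gt0 : 0 < s. Proof. exact: powR_gt0. Qed.

Let n_le_M : (n <= Msum dn)%N.
Proof. by rewrite -[X in (X <= _)%N]card_ord -sum1_card; apply: leq_sum. Qed.

Let M_gt0 : 0 < M.
Proof. by rewrite ltr0n; apply: leq_trans n_le_M; apply: leq_trans n_ge2. Qed.

Let D_gt0 : (0 < Dmax dn)%N.
Proof.
have v : 'I_n by exists 0%N; apply: leq_trans n_ge2.
exact: leq_trans (dn_ge1 v) (le_Dmax dn v).
Qed.

Let D_ge1 : 1 <= D. Proof. by rewrite ler1n. Qed.

(** The exponents 1/16, 1/32 and 1/64 of [delta] become the integer powers s^4, s^2 and s. *)
Lemma powR_sX k m : (k * m = 64)%N -> delta `^ (m%:R)^-1 = s ^+ k.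
Proof.
move=> km; rewrite -powR_mulrn ?(ltW s_gt0) // -powRrM; congr (_ `^ _).
have m0 : m%:R != 0 :> R by rewrite pnatr_eq0; apply/eqP => m0; rewrite m0 muln0 in km.
by apply: (mulIf m0); rewrite mulVf // -mulrA -natrM km mulVf // pnatr_eq0.
Qed.

Lemma s_pow64 : s ^+ 64 = delta.
Proof. by rewrite -(@powR_sX 64 1) // invr1 powRr1 // ltW. Qed.

Lemma C_def : C * (s ^+ 4 * p) = L.
Proof.
rewrite /Cp powRN (@powR_sX 4 16) //.
by field; rewrite !lt0r_neq0 ?exprn_gt0.
Qed.

Lemma sparse_scaled : D ^+ 2 * L ^+ 12 <= s ^+ 64 * p ^+ 13 * M.
Proof.
rewrite s_pow64; have p12 : 0 < p ^+ 12 by rewrite exprn_gt0.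
have -> : D ^+ 2 * L ^+ 12 = D ^+ 2 * p ^- 12 * L ^+ 12 * p ^+ 12.
  by field; rewrite lt0r_neq0.
have -> : delta * p ^+ 13 * M = delta * p * M * p ^+ 12 by ring.
by rewrite ler_pM2r.
Qed.

Let M_large : (2 * (6 + 2 * (Dmax dn * (Dmax dn).+1)) <= Msum dn)%N.
Proof.
have := D2_le s_gt0 s_le p01 L_ge2 M_gt0 sparse_scaled.
rewrite -!natrX -!natrM ler_nat; move: D_gt0; set x := Dmax dn; set m := Msum dn.
by clear; nia.
Qed.

Let Cp_gt0 : 0 < C := C_gt0 s_gt0 s_le p01 L_ge2 C_def.

Lemma ln_n_gt0 : 0 < ln n%:R :> R.
Proof. by rewrite ln_gt0 // ltr1n. Qed.

Lemma ln_n_le_ln_M : ln n%:R <= L.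
Proof.
have n0 : 0 < n%:R :> R by rewrite ltr0n; apply: leq_trans n_ge2.
by rewrite ler_ln ?posrE // ler_nat.
Qed.

(** Membership of [v] in [A] is left out, so that the count is a plain binomial and the Chernoff
    bound applies directly. *)
Definition deviates E v (A : {set 'I_n}) : bool :=
  9 * s * (p * #|nbh E v|%:R) < `| #|A :&: nbh E v|%:R - p * #|nbh E v|%:R |.

(** Since n <= M = exp(L), the left side is at most 2 exp(-19L) <= 2 exp(-L), and exp(L) >= L. *)
Lemma union_tail_le (e : R) : e <= - (20 * L) -> n%:R * (2 * expR e) <= 2 / L.
Proof.
move=> eL; have L0 : 0 < L by have := L_ge2; lra.
have M_exp : M = expR L by rewrite lnK.
apply: (@le_trans _ _ (expR L * (2 * expR (- (20 * L))))).
  apply: ler_pM; rewrite ?ler0n ?mulr_ge0 ?expR_ge0 //.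
    by rewrite -M_exp ler_nat.
  by rewrite ler_wpM2l // ler_expR.
rewrite mulrCA -expRD ler_wpM2l //.
have h : L <= expR L by apply: le_trans (expR_ge1Dx _); lra.
apply: (@le_trans _ _ (expR (- L))); first by rewrite ler_expR; lra.
by rewrite expRN lef_pV2 ?posrE ?expR_gt0.
Qed.

(** Multiplying the degree threshold by s^2 p gives 2s^4 pC = 2L, so the Chernoff exponent is at
    least (81/8) * 2L, which exceeds 20L. *)
Lemma large_degree_exponent v : 2 * s ^+ 2 * C < (dn v)%:R ->
  - ((9 * s) ^+ 2 * (p * (dn v)%:R) / 8) <= - (20 * L).
Proof.
move=> vC; rewrite lerN2.
have h : 2 * L <= s ^+ 2 * (p * (dn v)%:R).
  rewrite -C_def; have -> : 2 * (C * (s ^+ 4 * p)) = (2 * s ^+ 2 * C) * (s ^+ 2 * p) by ring.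
  by rewrite [leRHS]mulrA [leRHS]mulrC ler_wpM2r ?mulr_ge0 ?sqr_ge0 ?ltW.
have L0 : 0 <= L by have := L_ge2; lra.
have -> : (9 * s) ^+ 2 * (p * (dn v)%:R) / 8 = 81 / 8 * (s ^+ 2 * (p * (dn v)%:R)).
  by field.
by move: h L0; lra.
Qed.

Lemma bexp_deviates E v : E \in graphs_deg dn -> 2 * s ^+ 2 * C < (dn v)%:R ->
  n%:R * bexp p (fun A => (deviates E v A)%:R) <= 2 / L.
Proof.
move=> EG vC; have s1 : 0 < 9 * s <= 1.
  by apply/andP; split; have := s_gt0; have := s_le; lra.
apply: le_trans (union_tail_le (large_degree_exponent vC)).
rewrite ler_wpM2l ?ler0n // -(card_nbh_deg v EG).
exact: (binomial_chernoff p01 (nbh E v) s1).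
Qed.

Lemma high_degree v : C < (dn v)%:R -> 2 * s ^+ 2 * C < (dn v)%:R.
Proof.
apply: le_lt_trans; rewrite ler_piMl ?(ltW Cp_gt0) //.
have : s ^+ 2 <= (2 / 27) ^+ 2 by apply: lerXn2r; rewrite ?nnegrE ?(ltW s_gt0).
by rewrite expr2; lra.
Qed.

(** A count of at most pC/3 falls short of the mean p d(v) > pC by more than two thirds of it, and s
    <= 2/27 means 9s <= 2/3. *)
Lemma few_neighbours_deviate E v i (A : {set 'I_n}) : E \in graphs_deg dn ->
  C < (dn v)%:R -> i%:R <= p * C / 3 -> #|A :&: nbh E v| = i -> deviates E v A.
Proof.
move=> EG vC iC cA; rewrite /deviates cA (card_nbh_deg v EG) ltr_normr; apply/orP; right.
have h : p * C < p * (dn v)%:R by rewrite ltr_pM2l.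
have h2 : 9 * s * (p * (dn v)%:R) <= 2 / 3 * (p * (dn v)%:R).
  by apply: ler_wpM2r; [rewrite mulr_ge0 ?ler0n // ltW | have := s_le; lra].
by move: h h2 iC; lra.
Qed.

(** These probabilities do not depend on the graph, so any one [E] may be used: each is at most the
    deviation probability of its vertex, hence at most 1/n. *)
Lemma high_mean_le1 i : i%:R <= p * C / 3 ->
  \sum_(v | ~~ ((dn v)%:R <= C)) degS_prob dn p i v <= 1.
Proof.
move=> iC; have [E EG] : exists E, E \in graphs_deg dn by apply/card_gt0P.
have L1 : 2 / L <= 1 by rewrite ler_pdivrMr ?mul1r //; have := L_ge2; lra.
have n0 : 0 < n%:R :> R by rewrite ltr0n; apply: leq_trans n_ge2.
apply: (@le_trans _ _ (\sum_(v < n) n%:R^-1)); last first.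
  by rewrite sumr_const card_ord -[_ *+ _]mulr_natl divff // lt0r_neq0.
rewrite [leLHS]big_mkcond; apply: ler_sum => v _; case: ifP => [|_]; last by rewrite invr_ge0 ltW.
rewrite -ltNge => vC; rewrite -[leRHS]mulr1 ler_pdivlMl //.
apply: le_trans L1; apply: le_trans (bexp_deviates EG (high_degree vC)).
rewrite ler_wpM2l ?(ltW n0) // -(bexp_degS_ind p i v EG).
apply: bexp_le => // A; rewrite degS_indE; last by case/graphs_degP: EG.
rewrite ler_nat; case: eqP => [cA|]; last by rewrite andbF.
by rewrite (few_neighbours_deviate EG vC iC cA); case: (_ \in _).
Qed.

Let t (i : nat) : R := tolerance p L C (low_mean dn p C i).

Lemma degree_count_close E A i : E \in graphs_deg dn -> i%:R <= p * C / 3 ->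
  (forall v, 2 * s ^+ 2 * C < (dn v)%:R -> ~~ deviates E v A) ->
  low_deviation dn p C E i A ^+ 2 < t i ^+ 2 ->
  `| (nS E A i)%:R - (nA dn p i)%:~R |
       <= p * (nA dn p i)%:~R / C ^+ 3 + p * C ^+ 6 / Num.sqrt L.
Proof.
move=> EG iC nodev dev; have [sE _] := graphs_degP _ _ EG.
have mu0 : 0 <= low_mean dn p C i by apply: low_mean_ge0.
have t0 : 0 <= t i := ltW (tolerance_gt0 s_gt0 s_le p01 L_ge2 C_def mu0).
have := sqr_lt_norm_le t0 dev.
(* Without deviating vertices, no vertex of degree above [C] has degree [i] in the induced graph, so
   the low-degree count is all of [nS]. *)
have -> : low_deviation dn p C E i A = (nS E A i)%:R - low_mean dn p C i.
  rewrite /low_deviation (nS_sum R) [in RHS](bigID (fun v => (dn v)%:R <= C)) /=.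
  rewrite [X in _ = _ + X - _]big1 ?addr0 // => v; rewrite -ltNge => vC.
  rewrite degS_indE //; case: eqP => [cA|]; last by rewrite andbF.
  by have := nodev v (high_degree vC); rewrite (few_neighbours_deviate EG vC iC cA).
have := nA_dist dn p i.
have -> : p * \sum_v binpmf p (dn v) i = low_mean dn p C i +
    \sum_(v | ~~ ((dn v)%:R <= C)) degS_prob dn p i v.
  by rewrite mulr_sumr (bigID (fun v => (dn v)%:R <= C)).
have := high_mean_le1 iC.
have : 0 <= \sum_(v | ~~ ((dn v)%:R <= C)) degS_prob dn p i v.
  by apply: sumr_ge0 => v _; apply: degS_prob_ge0.
move: (\sum_(v | _) _) => h h0 h1.
have := slack_ge6 s_gt0 s_le p01 L_ge2 C_def.
rewrite /t /tolerance -/(slack p L C).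
move: (slack p L C) => y y6.
have c1 := p_div_C3_le1 s_gt0 s_le p01 L_ge2 C_def.
have c0 : 0 <= p / C ^+ 3 by rewrite divr_ge0 ?exprn_ge0 // ltW.
rewrite (mulrAC p) (mulrAC p _ (C ^+ 3)^-1).
move: c0 c1 mu0; move: (p / C ^+ 3) (low_mean dn p C i) ((nA dn p i)%:~R : R) ((nS E A i)%:R : R) => c mu a x c0 c1 mu0.
rewrite !ler_norml => /andP[a1 a2] /andP[x1 x2].
(* As [nA] is at least mu - 1 and c <= 1, replacing mu by [nA] in the relative term costs at most
   1. *)
have : c * (mu - 1) <= c * a by rewrite ler_wpM2l //; lra.
by move=> ca; apply/andP; split; move: ca; rewrite mulrBr mulr1; lra.
Qed.

Definition volume_tolerance : R := p ^+ 2 * M `^ (- (4%:R)^-1) * (p * M).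

Lemma good_event_criterion E (A : {set 'I_n}) : E \in graphs_deg dn ->
  (#|A|%:R - n%:R * p) ^+ 2 < 9 * (n%:R * p) * ln n%:R ->
  ((dsum dn A)%:R - p * M) ^+ 2 < volume_tolerance ^+ 2 ->
  (forall v, 2 * s ^+ 2 * C < (dn v)%:R -> ~~ deviates E v A) ->
  (forall i : nat, i%:R <= p * C / 3 -> low_deviation dn p C E i A ^+ 2 < t i ^+ 2) ->
  good_event dn p delta 0 E A.
Proof.
move=> EG hsize hvol hdev hlow; have [sE _] := graphs_degP _ _ EG.
have n0 : 0 < n%:R :> R by rewrite ltr0n; apply: leq_trans n_ge2.
have np0 : 0 < n%:R * p by rewrite mulr_gt0.
split; [|split; [|split]].
- apply: sqr_lt_norm_le; first by rewrite !mulr_ge0 ?sqrtr_ge0 // ltW.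
  apply: lt_le_trans hsize _; rewrite !exprMn sqr_sqrtr; last first.
    by rewrite divr_ge0 ?(ltW ln_n_gt0) // mulrC ltW.
  rewrite le_eqVlt; apply/orP; left; apply/eqP.
  by field; rewrite !lt0r_neq0.
- apply: sqr_lt_norm_le hvol.
  by rewrite !mulr_ge0 ?powR_ge0 ?ler0n ?(ltW p_gt0).
- move=> v vA; rewrite (@powR_sX 2 32) // (@powR_sX 1 64) // expr1 => vC.
  have := hdev v vC; rewrite /deviates -leNgt (card_nbh_deg v EG) degS_nbh //.
- by move=> i iC; rewrite addr0 mulr1; apply: degree_count_close => //; apply: hlow.
Qed.

(** * Markov's inequality for the failure events *)

Let I := (Num.truncn (p * C / 3)).+1.

(** A pointwise form of Markov's inequality: if the good event fails, one of the normalised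
    nonnegative terms is at least 1. *)
Lemma bad_event_indicator E (A : {set 'I_n}) : E \in graphs_deg dn ->
  1 <= (`[< good_event dn p delta 0 E A >])%:R +
    ((9 * (n%:R * p) * ln n%:R)^-1 * (#|A|%:R - n%:R * p) ^+ 2 +
    ((volume_tolerance ^+ 2)^-1 * ((dsum dn A)%:R - p * M) ^+ 2 +
    (\sum_(v | 2 * s ^+ 2 * C < (dn v)%:R) (deviates E v A)%:R +
     \sum_(i < I) (t i ^+ 2)^-1 * low_deviation dn p C E i A ^+ 2))) :> R.
Proof.
move=> EG; have n0 : 0 < n%:R :> R by rewrite ltr0n; apply: leq_trans n_ge2.
set X1 := _ * (_ - n%:R * p) ^+ 2; set X2 := _ * (_ - p * M) ^+ 2.
set X3 := \sum_(v | _) _; set X4 := \sum_(i < I) _.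
have a0 : 0 < 9 * (n%:R * p) * ln n%:R by rewrite !mulr_gt0 // ln_n_gt0.
have v0 : 0 < volume_tolerance ^+ 2.
  by rewrite exprn_gt0 // !mulr_gt0 ?exprn_gt0 ?powR_gt0.
have t0 i : 0 < t i ^+ 2.
  by apply/exprn_gt0/(tolerance_gt0 s_gt0 s_le p01 L_ge2 C_def)/low_mean_ge0.
have X10 : 0 <= X1 by rewrite mulr_ge0 ?sqr_ge0 // invr_ge0 ltW.
have X20 : 0 <= X2 by rewrite mulr_ge0 ?sqr_ge0 // invr_ge0 ltW.
have X30 : 0 <= X3 by apply: sumr_ge0.
have X40 : 0 <= X4 by apply: sumr_ge0 => i _; rewrite mulr_ge0 ?sqr_ge0 // invr_ge0 ltW.
case: (asboolP (good_event _ _ _ _ _ _)) => [_|bad]; first by rewrite lerDl !addr_ge0.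
rewrite add0r leNgt; apply/negP => lt1; apply: bad; apply: good_event_criterion => //.
- by rewrite -[ltRHS]mulr1 -ltr_pdivrMl //; rewrite -/X1; lra.
- by rewrite -[ltRHS]mulr1 -ltr_pdivrMl //; rewrite -/X2; lra.
- move=> v vC; apply/negP => dv; move: lt1.
  have : 1 <= X3 by rewrite /X3 (bigD1 v) //= dv lerDl sumr_ge0.
  by lra.
- move=> i iC; rewrite -[ltRHS]mulr1 -ltr_pdivrMl //.
  have iI : (i < I)%N.
    by rewrite ltnS truncn_ge_nat // divr_ge0 // mulr_ge0 // ltW.
  have : (t i ^+ 2)^-1 * low_deviation dn p C E i A ^+ 2 <= X4.
    rewrite /X4 (bigD1 (Ordinal iI)) //= lerDl sumr_ge0 // => j _.
    by rewrite mulr_ge0 ?sqr_ge0 // invr_ge0 ltW.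
  by lra.
Qed.

Lemma size_term_le :
  bexp p (fun A : {set 'I_n} => (9 * (n%:R * p) * ln n%:R)^-1 * (#|A|%:R - n%:R * p) ^+ 2) <= 1 / ln n%:R.
Proof.
have n0 : 0 < n%:R :> R by rewrite ltr0n; apply: leq_trans n_ge2.
have l0 := ln_n_gt0.
rewrite bexpZ.
have -> : bexp p (fun A : {set 'I_n} => (#|A|%:R - n%:R * p) ^+ 2) = p * (1 - p) * n%:R.
  have := bexp_linear_variance p (fun=> 1 : R) => /(_ n).
  have -> : \sum_(i < n) (1 : R) ^+ 2 = n%:R.
    by rewrite (eq_bigr (fun=> 1)) => [|i _]; rewrite ?expr1n // sumr_const card_ord.
  move=> <-; apply: eq_bexp => A; congr (_ ^+ 2).
  by rewrite !sumr_const card_ord [p * _]mulrC.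
rewrite ler_pdivrMl ?mulr_gt0 //.
have -> : 9 * (n%:R * p) * ln n%:R * (1 / ln n%:R) = 9 * (p * n%:R).
  by field; rewrite lt0r_neq0.
have pn0 : 0 < p * n%:R by rewrite mulr_gt0.
have : p * n%:R * (1 - p) <= p * n%:R * 1 by apply: ler_wpM2l; [exact: ltW | have := p_gt0; lra].
by rewrite mulrAC; move: pn0; lra.
Qed.

(** The variance is at most pDM. With r = M^(-1/4), so that r^4 M = 1, Chebyshev reduces to DL <=
    p^5 r^2 M, whose square is [DL_sq_le]. *)
Lemma volume_term_le :
  bexp p (fun A => (volume_tolerance ^+ 2)^-1 * ((dsum dn A)%:R - p * M) ^+ 2) <= 1 / L.
Proof.
have L0 : 0 < L by have := L_ge2; lra.
have v0 : 0 < volume_tolerance ^+ 2.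
  by rewrite exprn_gt0 // !mulr_gt0 ?exprn_gt0 ?powR_gt0.
rewrite bexpZ ler_pdivrMl // mulrA mulr1 ler_pdivlMr //.
have -> : bexp p (fun A => ((dsum dn A)%:R - p * M) ^+ 2) =
    p * (1 - p) * \sum_i (dn i)%:R ^+ 2.
  rewrite -bexp_linear_variance; apply: eq_bexp => A.
  by rewrite /dsum /Msum !natr_sum.
pose r := M `^ (- (4%:R)^-1).
have r0 : 0 < r by apply: powR_gt0.
have rM : r ^+ 4 * M = 1.
  rewrite -powR_mulrn ?(ltW r0) // -powRrM mulNr mulVf ?pnatr_eq0 //.
  by rewrite powR_inv1 ?(ltW M_gt0) // mulVf // lt0r_neq0.
apply: (@le_trans _ _ (p * (D * M) * L)).
  apply: ler_wpM2r; first exact: ltW.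
  apply: (@le_trans _ _ (p * \sum_i (dn i)%:R ^+ 2)).
    apply: ler_wpM2r; first by apply: sumr_ge0 => i _; rewrite sqr_ge0.
    by apply: ler_piMr; [exact: ltW | have := p_gt0; lra].
  by apply: ler_wpM2l; [exact: ltW | exact: sum_degree_sq].
have DL : D * L <= p ^+ 5 * r ^+ 2 * M.
  rewrite -(ler_pXn2r (n := 2)) ?nnegrE ?mulr_ge0 ?exprn_ge0 ?ler0n ?(ltW L0) ?(ltW p_gt0) ?(ltW r0) //.
  have -> : (p ^+ 5 * r ^+ 2 * M) ^+ 2 = p ^+ 10 * M * (r ^+ 4 * M) by ring.
  by rewrite rM mulr1; apply: (DL_sq_le s_gt0 s_le p01 L_ge2 M_gt0 sparse_scaled).
rewrite /volume_tolerance -/r.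
have -> : p * (D * M) * L = p * M * (D * L) by ring.
have -> : (p ^+ 2 * r * (p * M)) ^+ 2 = p * M * (p ^+ 5 * r ^+ 2 * M) by ring.
by rewrite ler_wpM2l // mulr_ge0 // ltW.
Qed.

Lemma deviation_term_le E : E \in graphs_deg dn ->
  bexp p (fun A => \sum_(v | 2 * s ^+ 2 * C < (dn v)%:R) (deviates E v A)%:R) <= 2 / L.
Proof.
move=> EG; rewrite bexp_sum.
have n0 : 0 < n%:R :> R by rewrite ltr0n; apply: leq_trans n_ge2.
have L0 : 0 < L by have := L_ge2; lra.
apply: (@le_trans _ _ (\sum_(v < n) (2 / L) / n%:R)); last first.
  by rewrite sumr_const card_ord -[_ *+ _]mulr_natl mulrC divfK // lt0r_neq0.
rewrite [leLHS]big_mkcond; apply: ler_sum => v _; case: ifP => [vC|_].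
  by rewrite ler_pdivlMr // mulrC bexp_deviates.
by rewrite !divr_ge0 // ltW.
Qed.

Lemma count_term_le :
  gavg dn (fun E => bexp p (fun A => \sum_(i < I) (t i ^+ 2)^-1 * low_deviation dn p C E i A ^+ 2))
  <= (13 + 6 / eps ^+ 2) / L.
Proof.
have L0 : 0 < L by have := L_ge2; lra.
have pC0 : 0 < p * C by rewrite mulr_gt0.
set B := (13 + _) / L.
(* The number of values of [i] is at most pC/3 + 1, hence at most pC because pC >= L >= 2. This is
   the factor pC in [chebyshev_ratio]. *)
have I_le : I%:R <= p * C.
  have := ln_le_pC s_gt0 s_le p01 L_ge2 C_def; have := L_ge2.
  have : (Num.truncn (p * C / 3))%:R <= p * C / 3 by rewrite truncn_le divr_ge0 // ltW.
  rewrite (_ : I%:R = (Num.truncn (p * C / 3))%:R + 1); last by rewrite natr1.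
  by set x := p * C; set y := (Num.truncn _)%:R; lra.
have B0 : 0 <= B by rewrite divr_ge0 ?(ltW L0) // addr_ge0 // divr_ge0 ?sqr_ge0.
rewrite (_ : gavg _ _ = \sum_(i < I) (t i ^+ 2)^-1 *
    gavg dn (fun E => bexp p (fun A => low_deviation dn p C E i A ^+ 2))); last first.
  rewrite -(eq_bigr _ (fun i _ => gavgZ _ _ _)) -gavg_sum; congr (_ * _).
  by apply: eq_bigr => E _; rewrite bexp_sum; apply: eq_bigr => i _; rewrite bexpZ.
apply: (@le_trans _ _ (\sum_(i < I) B / (p * C))); last first.
  rewrite sumr_const card_ord -[_ *+ _]mulr_natl mulrCA ler_piMr //.
  by rewrite ler_pdivrMr ?mul1r.
apply: ler_sum => i _; rewrite ler_pdivlMr // mulrC.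
have mu0 : 0 <= low_mean dn p C i by apply: low_mean_ge0.
have t20 : 0 < t i ^+ 2 by apply/exprn_gt0/(tolerance_gt0 s_gt0 s_le p01 L_ge2 C_def).
apply: le_trans (chebyshev_ratio s_gt0 s_le p01 L_ge2 M_gt0 D_ge1 C_def sparse_scaled eps_gt0 p_lt mu0).
apply: ler_wpM2l; first exact: ltW.
rewrite mulrC; apply: ler_wpM2r; first by rewrite invr_ge0 ltW.
by apply: variance_le => //; apply: ltW.
Qed.

Lemma prob_gavg (P : {set {set 'I_n}} -> {set 'I_n} -> Prop) :
  prob dn p P = gavg dn (fun E => bexp p (fun A => (`[< P E A >])%:R)).
Proof. by []. Qed.

Lemma prob_le1 (P : {set {set 'I_n}} -> {set 'I_n} -> Prop) : prob dn p P <= 1.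
Proof.
rewrite prob_gavg -[leRHS](gavg_cst graph_exists); apply: gavg_le => E _.
by rewrite -[leRHS](@bexp_cst R n p); apply: bexp_le => // A; case: asbool.
Qed.

(** The failure bounds add up to 1/ln n + (1 + 2)/L + (13 + 6/eps^2)/L, and 1/L <= 1/ln n. *)
Lemma good_event_prob_ge :
  1 - (17 + 6 / eps ^+ 2) / ln n%:R <= prob dn p (good_event dn p delta 0).
Proof.
rewrite lerBlDr prob_gavg -[leLHS](gavg_cst graph_exists).
apply: (@le_trans _ _ (gavg dn (fun E =>
   bexp p (fun A => (`[< good_event dn p delta 0 E A >])%:R) +
   ((1 / ln n%:R + (1 / L + 2 / L)) +
    bexp p (fun A => \sum_(i < I) (t i ^+ 2)^-1 * low_deviation dn p C E i A ^+ 2))))).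
  apply: gavg_le => E EG; rewrite -[leLHS](@bexp_cst R n p).
  apply: le_trans (bexp_le p01 (fun A => bad_event_indicator A EG)) _.
  rewrite !bexpD lerD2l !addrA lerD2r -!addrA.
  by rewrite !lerD ?size_term_le ?volume_term_le ?deviation_term_le.
rewrite !gavgD !gavg_cst // lerD2l.
have l0 := ln_n_gt0; have L0 : 0 < L by have := L_ge2; lra.
apply: le_trans (lerD (lexx _) count_term_le) _.
have e0 : 0 <= 6 / eps ^+ 2 by rewrite divr_ge0 ?sqr_ge0.
have : L^-1 <= (ln n%:R)^-1 by rewrite lef_pV2 ?posrE // ln_n_le_ln_M.
set x := L^-1; set y := (ln n%:R)^-1 => xy.
have : (16 + 6 / eps ^+ 2) * x <= (16 + 6 / eps ^+ 2) * y.
  by apply: ler_wpM2l => //; lra.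
by rewrite !mulrDl; lra.
Qed.

End FixedSize.

(** * The limit *)

Local Open Scope classical_set_scope.

Theorem theorem2p6 (R : realType) (d : forall n : nat, 'I_n -> nat)
  (p delta : nat -> R) (eps : R) :
  0 < eps ->
  (\forall n \near \oo, forall i : 'I_n, (1 <= d n i)%N) ->
  (\forall n \near \oo, forall i j : 'I_n, (i <= j)%N -> (d n i <= d n j)%N) ->
  (\forall n \near \oo, ~~ odd (Msum (d n))) ->
  (\forall n \near \oo, 0 < p n < 1) ->
  (\forall n \near \oo, p n < 1 - eps) ->
  (\forall n \near \oo, 0 < delta n) ->
  delta n @[n --> \oo] --> (0 : R) ->
  (exists K : R, \forall n \near \oo,
      (delta n)^-1 <= K * ln (ln (Msum (d n))%:R)) ->
  (\forall n \near \oo,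
      ((Dmax (d n))%:R) ^+ 2 * (p n) ^- 12 * (ln (Msum (d n))%:R) ^+ 12
        <= delta n * p n * (Msum (d n))%:R) ->
  (\forall n \near \oo, (0 < #|graphs_deg (d n)|)%N) ->
  exists eta : nat -> R, eta n @[n --> \oo] --> (0 : R) /\
    prob (d n) (p n) (good_event (d n) (p n) (delta n) (eta n)) @[n --> \oo] --> (1 : R).
Proof.
move=> eps0 d_ge1 _ _ p01 p_lt delta_gt0 delta0 _ sparse graph_ex.
exists (fun=> 0); split; first exact: cvg_cst.
apply/cvgrPdist_le => e e0.
have root_small : \forall n \near \oo, delta n `^ (64%:R)^-1 <= 2 / 27.
  have c0 : 0 < (2 / 27 : R) ^+ 64 by rewrite exprn_gt0.
  near=> n; have d0 : 0 < delta n by near: n.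
  have dn_le : delta n <= (2 / 27) ^+ 64 by near: n; apply: (cvgr_le _ delta0).
  have -> : (2 / 27 : R) = ((2 / 27) ^+ 64) `^ (64%:R)^-1.
    by rewrite -powR_mulrn // -powRrM divff ?powRr1.
  by apply: ge0_ler_powR; rewrite ?nnegrE ?(ltW d0) ?(ltW c0).
have n_large (x : R) : \forall n \near \oo, x <= ln n%:R.
  near=> n.
  have xn : expR x <= n%:R by near: n; apply: nbhs_infty_ger.
  by rewrite -[x]expRK ler_ln ?posrE ?expR_gt0 // (lt_le_trans (expR_gt0 _) xn).
near=> n.
have n2 : (2 <= n)%N by near: n; apply: nbhs_infty_ge.
have d1 v : (1 <= d n v)%N by move: v; near: n.
have l2 : 2 <= ln n%:R :> R by near: n; apply: n_large.
have nM : (n <= Msum (d n))%N.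
  by rewrite -[X in (X <= _)%N]card_ord -sum1_card; apply: leq_sum.
have L2 : 2 <= ln (Msum (d n))%:R :> R.
  apply: le_trans l2 _; have n0 : 0 < n%:R :> R by rewrite ltr0n; apply: leq_trans n2.
  by rewrite ler_ln ?posrE ?ler_nat // (lt_le_trans n0) // ler_nat.
have p01n : 0 < p n < 1 by near: n.
have graph_n : (0 < #|graphs_deg (d n)|)%N by near: n.
have prob1 := prob_le1 p01n graph_n (good_event (d n) (p n) (delta n) 0).
(* The probability is at most 1, so only the lower bound remains; it suffices that ln n is at least
   (17 + 6/eps^2)/e. *)
rewrite ger0_norm ?subr_ge0 // lerBlDr addrC -lerBlDr.
apply: le_trans (good_event_prob_ge n2 d1 p01n eps0 _ _ _ L2 graph_n _); try by near: n.
rewrite lerD2l lerN2 ler_pdivrMr; last by apply: lt_le_trans l2.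
by rewrite -ler_pdivrMl //; near: n; apply: n_large.
Unshelve. all: by end_near.
Qed.
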